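(* Let $W(y)=A_Ny^N+\dots+A_0\in\mathbb C^{p\times p}[y]$ be a matrix polynomial of degree $N$ (its leading coefficient $A_N\neq 0_p$ may be singular) with $\sigma(W(y))\cap\operatorname{supp}_y(u)=\varnothing$, and let $\check u_{x,y}=u_{x,y}(W(y))^{-1}+v_{x,y}$, where $v_{x,y}W(y)=0_p$. Assume $u$ and $\check u$ are quasidefinite, and let $R_{k,l}:=\langle P^{[1]}_k(x),I_py^l\rangle_{\check u}$. For $n\ge N$ and any poised set of indexes, $$\check P^{[1]}_n(x)=\Theta_*\begin{bmatrix}R_n^{\square}&\begin{matrix}P^{[1]}_{n-N}(x)\\ \vdots\\ P^{[1]}_{n-1}(x)\end{matrix}\\ r_n^{\square}&P^{[1]}_n(x)\end{bmatrix},\qquad \big(\check P^{[2]}_n(y)\big)^\top A_N=-\Theta_*\begin{bmatrix}R_n^{\square}&\begin{matrix}H_{n-N}\\ 0_p\\ \vdots\\ 0_p\end{matrix}\\ (r^K_n(y))^{\square}&0_p\end{bmatrix},$$ and there are two alternative expressions for $\check H_n$: $$\check H_n=\Theta_*\begin{bmatrix}R_n^{\square}&\begin{matrix}R_{n-N,n}\\ \vdots\\ R_{n-1,n}\end{matrix}\\ r_n^{\square}&R_{n,n}\end{bmatrix}=\Theta_*\begin{bmatrix}R_n^{\square}&\begin{matrix}H_{n-N}\\ 0_p\\ \vdots\\ 0_p\end{matrix}\\ r_n^{\square}&0_p\end{bmatrix}.$$ For $n<N$, $\check H_n=\Theta_*(R_{[n+1]})$ and $$\check P^{[1]}_n(x)=\Theta_*\begin{bmatrix}R_{0,0}&\dots&R_{0,n-1}&P^{[1]}_0(x)\\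 \vdots&&\vdots&\vdots\\ R_{n,0}&\dots&R_{n,n-1}&P^{[1]}_n(x)\end{bmatrix},\qquad \big(\check P^{[2]}_n(y)\big)^\top=\Theta_*\begin{bmatrix}R_{0,0}&\dots&R_{0,n-1}&R_{0,n}\\ \vdots&&\vdots&\vdots\\ R_{n-1,0}&\dots&R_{n-1,n-1}&R_{n-1,n}\\ I_p&\dots&I_py^{n-1}&I_py^n\end{bmatrix}.$$
   Context: Notation. $p\ge1$ is fixed; $I_p,0_p$ are the $p\times p$ identity and zero matrices. Semi-infinite matrices are written in $p\times p$ blocks indexed by $0,1,2,\dots$; $A_{[n]}$ is the truncation to the first $n$ block rows and columns. $\chi(x)=[I_p,I_px,I_px^2,\dots]^\top$. The last quasideterminant of a block matrix with $A$ square nonsingular is $\Theta_*\begin{bmatrix}A&B\\ C&D\end{bmatrix}=D-CA^{-1}B$, with $D$ the last $p\times p$ block (a single block is its own last quasideterminant). Generalized kernels. $u=u_{x,y}$ is a $p\times p$ matrix of fast decreasing distributions in the real variables $(x,y)$ (distributions $w$ such that $(1+x^2+y^2)^{k/2}w$ is a bounded distribution for all $k$); the projections $\operatorname{supp}_x(u),\operatorname{supp}_y(u)$ of its support are assumed bounded. The sesquilinear form is $\big(\langle P(x),Q(y)\rangle_u\big)_{i,j}=\sum_{k,l}\langle (u_{x,y})_{k,l},P_{i,k}(x)Q_{j,l}(y)\rangle$, for matrix polynomials and for matrix functions smooth near the support. $\sigma(W)$ is the zero set of $\det W$. $uW(y)$ and $u(W(y))^{-1}$ have forms $\langle P,Q(y)(W(y))^{\top}\rangle_u$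 and $\langle P,Q(y)(W(y))^{-\top}\rangle_u$. Gram matrix: $G_{k,l}=\langle I_px^k,I_py^l\rangle_u$. $u$ is quasidefinite if $\det G_{[k]}\ne0$ for all $k\ge1$; then $G=S_1^{-1}HS_2^{-\top}$ uniquely, with $S_1,S_2$ lower unitriangular by blocks and $H=\operatorname{diag}(H_0,H_1,\dots)$. $P^{[i]}(x)=S_i\chi(x)$ has blocks $P^{[i]}_n$ (monic, degree $n$, $\langle P^{[1]}_n,P^{[2]}_m\rangle_u=\delta_{n,m}H_n$). The objects $\check P^{[1]}_n,\check P^{[2]}_n,\check H_n$ are those of $\check u$. $K_n(x,y)=\sum_{k=0}^n(P^{[2]}_k(y))^\top H_k^{-1}P^{[1]}_k(x)$. $R=(R_{k,l})_{k,l\ge0}$ is the semi-infinite block matrix defined in the claim. For $l\in\{0,\dots,n-1\}$, $r^K_{n,l}(z):=\langle W(z)K_{n-1}(x,z),I_py^l\rangle_{\check u}-I_pz^l\in\mathbb C^{p\times p}[z]$ (pairing in $x$ and $y$, $z$ a parameter). Poised sets. Let $n\ge N$ and let $I$ be a set of $Np$ distinct couples $(i,a)$, $0\le i\le n-1$, $1\le a\le p$, ordered lexicographically. $R_n^\square\in\mathbb C^{Np\times Np}$ is the matrix whose column attached to $(i,a)\in I$ is the $a$-th column of $\begin{bmatrix}R_{n-N,i}\\ \vdots\\ R_{n-1,i}\end{bmatrix}$; $r_n^\square\in\mathbb C^{p\times Np}$ (resp. $(r^K_n(y))^\square$) is the matrix whose column attached to $(i,a)$ is the $a$-th column of $R_{n,i}$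 (resp. of $r^K_{n,i}(y)$). $I$ is poised if $R_n^\square$ is nonsingular.
   Formalization: The second expression for Ȟ_n is proved as Ȟ_n A_N = Θ_*[…] (printed without A_N it is false unless A_N = I_p), and the two formulas with the column (H_{n-N},0_p,…,0_p) are stated for N ≥ 1 only. *)

(* Defs.v *)
From HB Require Import structures.
From mathcomp Require Import all_boot all_order all_algebra.
From mathcomp Require Import all_classical all_reals all_analysis.
From mathcomp Require Import complex.

Set Implicit Arguments.
Unset Strict Implicit.
Unset Printing Implicit Defensive.

Import Order.TTheory GRing.Theory Num.Theory.
Import numFieldNormedType.Exports.

Local Open Scope classical_set_scope.
Local Open Scope ring_scope.
Local Open Scope complex_scope.


Section Distributions.
Variable R : realType.
Local Notation C := R[i].
Implicit Types phi : R * R -> C.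

Definition e_x : R * R := (1, 0).
Definition e_y : R * R := (0, 1).

Fixpoint is_Ck (k : nat) (f : R * R -> R) : Prop :=
  continuous f /\
  if k is k'.+1 then
    [/\ (forall z, derivable f z e_x), (forall z, derivable f z e_y),
        is_Ck k' (fun z => 'D_e_x f z) & is_Ck k' (fun z => 'D_e_y f z)]
  else True.

(* Smoothness is expressed on real and imaginary parts because [R[i]] carries
   no [normedModType R] structure in the library. *)
Definition smooth (f : R * R -> C) : Prop :=
  forall k, is_Ck k (fun z => complex.Re (f z)) /\
            is_Ck k (fun z => complex.Im (f z)).

Definition partial (a b : nat) (f : R * R -> R) : R * R -> R :=
  iter a (fun g z => 'D_e_x g z) (iter b (fun g z => 'D_e_y g z) f).

Definition cpartial (a b : nat) (f : R * R -> C) (z : R * R) : C :=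
  partial a b (fun t => complex.Re (f t)) z
  +i* partial a b (fun t => complex.Im (f t)) z.

Definition tsupp (f : R * R -> C) : set (R * R) :=
  closure [set z | f z != 0].

Definition test_function (f : R * R -> C) : Prop :=
  smooth f /\ compact (tsupp f).

(* Only the values on test functions are meaningful. *)
Definition functional : Type := (R * R -> C) -> C.

Definition distribution (w : functional) : Prop :=
  (forall (a : C) (phi f : R * R -> C), test_function phi -> test_function f ->
     w (fun z => a * phi z + f z) = a * w phi + w f) /\
  (forall K : set (R * R), compact K ->
     exists (M : R) (m : nat), forall phi, test_function phi ->
       tsupp phi `<=` K -> forall B : R,
       (forall a b z, (a + b <= m)%N -> Normc.normc (cpartial a b phi z) <= B) ->
       Normc.normc (w phi) <= M * B).

(* Boundedness in the sense of Schwartz: [w] extends continuously to the space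
   of smooth functions all of whose derivatives are integrable. *)
Definition bounded_distribution (w : functional) : Prop :=
  distribution w /\
  exists (M : R) (m : nat), forall phi, test_function phi ->
    ((Normc.normc (w phi))%:E <= M%:E *
       \sum_(a < m.+1) \sum_(b < m.+1 | (a + b <= m)%N)
         \int[(@lebesgue_measure R \x @lebesgue_measure R)%E]_z
           (Normc.normc (cpartial a b phi z))%:E)%E.

Definition weight (k : nat) (z : R * R) : C :=
  (Num.sqrt (1 + z.1 ^+ 2 + z.2 ^+ 2) ^+ k)%:C.

Definition fast_decreasing (w : functional) : Prop :=
  distribution w /\
  forall k : nat, bounded_distribution (fun phi => w (fun z => weight k z * phi z)).

Definition vanishes_on (w : functional) (U : set (R * R)) : Prop :=
  forall phi, test_function phi -> tsupp phi `<=` U -> w phi = 0.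

Definition dsupp (w : functional) : set (R * R) :=
  [set z | forall U, open U -> U z -> ~ vanishes_on w U].

(* For [w] with compact support and [f] smooth only near that support,
   <w, f> is the value of [w] at any test function which coincides with [f] in
   a neighbourhood of the support; it does not depend on the chosen one. *)
Definition pairing (w : functional) (f : R * R -> C) : C :=
  xget 0 [set c | exists g, [/\ test_function g,
    (exists U, [/\ open U, dsupp w `<=` U & forall z, U z -> g z = f z])
    & c = w g]].

End Distributions.


Section Kernels.
Variables (R : realType) (p : nat).
Local Notation C := R[i].
Local Notation kernel := 'M[functional R]_p.

Definition supp_x (u : kernel) : set R :=
  [set x | exists k l y, dsupp (u k l) (x, y)].

Definition supp_y (u : kernel) : set R :=
  [set y | exists k l x, dsupp (u k l) (x, y)].

Definition generalized_kernel (u : kernel) : Prop :=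
  [/\ (forall k l, fast_decreasing (u k l)),
      bounded_set (supp_x u) & bounded_set (supp_y u)].

Definition form (u : kernel) (F G : R -> 'M[C]_p) : 'M[C]_p :=
  \matrix_(i, j) \sum_k \sum_l
    pairing (u k l) (fun z => F z.1 i k * G z.2 j l).

(* Matrix polynomials are matrices with polynomial entries. *)
Definition meval (P : 'M[{poly C}]_p) (z : C) : 'M[C]_p :=
  map_mx (fun q : {poly C} => q.[z]) P.

Definition rmeval (P : 'M[{poly C}]_p) (t : R) : 'M[C]_p := meval P t%:C.

Definition matpoly (N : nat) (A : nat -> 'M[C]_p) : 'M[{poly C}]_p :=
  \sum_(m < N.+1) 'X^m *: map_mx polyC (A m).

Definition spectrum (W : 'M[{poly C}]_p) : set C := [set z | root (\det W) z].

Definition mulk (v : kernel) (W : 'M[{poly C}]_p) : kernel :=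
  \matrix_(k, l) (fun phi => \sum_m
    v k m (fun z => phi z * rmeval W z.2 m l)).

(* [u W^-1]: the inverse of [W] is smooth only near the support of [u], whence
   the use of [pairing]. *)
Definition divk (u : kernel) (W : 'M[{poly C}]_p) : kernel :=
  \matrix_(k, l) (fun phi => \sum_m
    pairing (u k m) (fun z => phi z * invmx (rmeval W z.2) m l)).

Definition addk (u v : kernel) : kernel :=
  \matrix_(k, l) (fun phi => u k l phi + v k l phi).

Definition null_kernel (v : kernel) : Prop :=
  forall k l phi, test_function phi -> v k l phi = 0.

Definition mono (l : nat) (t : R) : 'M[C]_p := ((t%:C) ^+ l)%:M.


Definition bmx : Type := nat -> nat -> 'M[C]_p.

Definition trunc (A : bmx) (n : nat) : 'M[C]_(\sum_(i < n) p) :=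
  \mxblock_(i < n, j < n) A i j.

Definition gram (u : kernel) : bmx := fun k l => form u (mono k) (mono l).

Definition quasidefinite (u : kernel) : Prop :=
  forall k, (0 < k)%N -> \det (trunc (gram u) k) != 0.

Definition lower_unitriangular (S : bmx) : Prop :=
  (forall k, S k k = 1%:M) /\ (forall k l, (k < l)%N -> S k l = 0).

(* The product of [A] and [B] for [A] lower triangular by blocks. *)
Definition ltmul (A B : bmx) : bmx :=
  fun k l => \sum_(j < k.+1) A k j *m B j l.

Definition idb : bmx := fun k l => if k == l then 1%:M else 0.

Definition diagb (H : nat -> 'M[C]_p) : bmx :=
  fun k l => if k == l then H k else 0.

Definition trb (A : bmx) : bmx := fun k l => (A l k)^T.

Definition ltinverse (S L : bmx) : Prop :=
  [/\ lower_unitriangular L, ltmul S L = idb & ltmul L S = idb].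

(* [G = S1^-1 H S2^-T], with [L1] and [L2] the inverses of [S1] and [S2]. *)
Definition gauss_borel (G S1 S2 : bmx) (H : nat -> 'M[C]_p) : Prop :=
  [/\ lower_unitriangular S1, lower_unitriangular S2 &
      exists L1 L2, [/\ ltinverse S1 L1, ltinverse S2 L2 &
        G = ltmul L1 (ltmul (diagb H) (trb L2))]].

(* The [n]-th block of [S chi(x)]. *)
Definition bpoly (S : bmx) (n : nat) : 'M[{poly C}]_p := matpoly n (S n).

(* Christoffel-Darboux kernel [K_n(x, y)], at a fixed complex [y], as a matrix
   polynomial in [x]. *)
Definition CDkernel (S1 S2 : bmx) (H : nat -> 'M[C]_p) (n : nat) (y : C)
    : 'M[{poly C}]_p :=
  \sum_(k < n.+1)
    map_mx polyC ((meval (bpoly S2 k) y)^T *m invmx (H k)) *m bpoly S1 k.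

(* [uc] stands for the perturbed kernel. *)
Definition Rmx (uc : kernel) (S1 : bmx) : bmx :=
  fun k l => form uc (rmeval (bpoly S1 k)) (mono l).

(* Meant for [l < n], so that [n.-1] is a genuine predecessor. *)
Definition rK (uc : kernel) (W : 'M[{poly C}]_p) (S1 S2 : bmx)
    (H : nat -> 'M[C]_p) (n l : nat) (z : C) : 'M[C]_p :=
  form uc (rmeval (map_mx polyC (meval W z) *m CDkernel S1 S2 H n.-1 z)) (mono l)
  - (z ^+ l)%:M.


Definition last_quasidet (m : nat) (A : 'M[C]_m) (B : 'M[C]_(m, p))
    (D : 'M[C]_(p, m)) (E : 'M[C]_p) : 'M[C]_p :=
  E - D *m invmx A *m B.

(* A set of couples, given by its increasing lexicographic enumeration. The
   number of couples is written [\sum_(k < N) p], which is [N * p], so as to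
   match the size of a column of [N] blocks. *)
Definition lex_set (N n : nat) (I : 'I_(\sum_(k < N) p) -> 'I_n * 'I_p) : Prop :=
  forall c d : 'I_(\sum_(k < N) p), (c < d)%N ->
    ((I c).1 < (I d).1)%N \/ ((I c).1 = (I d).1 /\ ((I c).2 < (I d).2)%N).

Definition sel (N n : nat) (I : 'I_(\sum_(k < N) p) -> 'I_n * 'I_p)
    (f : nat -> 'M[C]_p) : 'M[C]_(p, \sum_(k < N) p) :=
  \matrix_(b, c) f (I c).1 b (I c).2.

Definition Rsq (N n : nat) (I : 'I_(\sum_(k < N) p) -> 'I_n * 'I_p) (A : bmx)
    : 'M[C]_(\sum_(k < N) p) :=
  \mxcol_(k < N) sel I (A (n - N + k)%N).

Definition poised (N n : nat) (I : 'I_(\sum_(k < N) p) -> 'I_n * 'I_p)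
    (A : bmx) : Prop :=
  lex_set I /\ Rsq I A \in unitmx.

(* The block column [M; 0; ...; 0] with [N] blocks. *)
Definition first_block (N : nat) (M : 'M[C]_p) : 'M[C]_(\sum_(k < N) p, p) :=
  \mxcol_(k < N) (if k == 0%N :> nat then M else 0).

End Kernels.

(* Main.v *)
Require Import Defs.
From mathcomp Require Import all_boot all_order all_algebra.
From mathcomp Require Import all_classical all_reals all_analysis.
From mathcomp Require Import complex ring lra zify.

Import Order.TTheory GRing.Theory Num.Theory.
Import numFieldNormedType.Exports.
Local Open Scope classical_set_scope.
Local Open Scope ring_scope.
Local Open Scope complex_scope.

Set Implicit Arguments.
Unset Strict Implicit.
Unset Printing Implicit Defensive.

(** The whole theorem rests on one identity: on matrix polynomials,
    [<F, G W^T>_uc = <F, G>_u], where [uc = u W^-1 + v]. The term in [v]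
    disappears because [v W = 0], and near the support of [u] the factor [W]
    cancels [W^-1] ([form_perturbation]). Everything else is linear algebra.

    Both forms are sesquilinear on matrix polynomials, and a Gauss-Borel
    factorization of a Gram matrix says exactly that the two families of
    polynomials are biorthogonal with pivots [H] ([bpoly_bpoly]). Let
    [w = Sc1 S1^-1] be the unitriangular matrix which expands the perturbed
    polynomials [Pc1_n] in the [P1_k]. Then [w_{n,k} H_k = <Pc1_n, P2_k>_u
    = <Pc1_n, P2_k W^T>_uc], and [P2_k W^T] has degree at most [k + N], with
    coefficient [A_N^T] in that degree. So [w_{n,k} = 0] for [k + N < n] and
    [w_{n,n-N} H_{n-N} = Hc_n A_N]: only [N] unknown blocks remain in row [n].
    Orthogonality of [Pc1_n] to [1, ..., y^{n-1}] is a linear system for them,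
    with coefficients [R_{k,l}]; a poised set selects [N p] scalar columns
    which determine the solution, and substituting it gives a
    quasideterminant ([quasidet_row]).

    The second family is reached through Christoffel-Darboux kernels. Put
    [D(x) = W(z) K_{n-1}(x,z) - Kc_{n-1}(x,z)] and let [T] be the defect of
    reproduction, [T(Q) = Q(z)^T - <Kc_{n-1}(.,z), Q>_uc]. It kills all degrees
    below [n], and the coefficient of [D] on [P1_k], multiplied by [H_k], is
    [T(P2_k W^T)]. By the same degree count this vanishes for [k + N < n] and
    equals [Pc2_n(z)^T A_N] for [k + N = n], while [r^K_{n,l}(z) = <D, y^l>_uc];
    hence the same linear system, with right-hand side [r^K], has
    [Pc2_n(z)^T A_N H_{n-N}^-1] as its first block.
    For [n < N] the truncation [R_[n]] is the product of the truncations of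
    [S1] and of the Gram matrix of [uc], hence invertible, and the orthogonality
    relations of [Pc1_n] and of [Pc2_n] are systems with this matrix
    ([trunc_row], [trunc_col]).

    The analytic part gives a meaning to the pairing of a distribution of
    compact support with a function smooth only near the support. It needs
    smooth cutoff functions, built from [exp(-1/t)] and glued by compactness
    ([cutoff]), and the fact that a functional vanishes on test functions which
    vanish near its support ([functional_local]). *)

(** * Functions of class C^k on the plane *)

Section RealSmooth.
Variable R : realType.
Implicit Types (f g : R * R -> R) (h : R -> R).

Lemma is_Ck_cont k f : is_Ck k f -> continuous f.
Proof. by case: k => [|k] []. Qed.

Lemma is_CkS k f fx fy : continuous f ->
  (forall z : R * R, is_derive z (e_x R) f (fx z)) ->
  (forall z : R * R, is_derive z (e_y R) f (fy z)) ->
  is_Ck k fx -> is_Ck k fy -> is_Ck k.+1 f.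
Proof.
move=> cf dx dy Cx Cy; split=> //; split.
- by move=> z; case: (dx z).
- by move=> z; case: (dy z).
- by rewrite (_ : (fun z => _) = fx)//; apply/funext => z; case: (dx z).
- by rewrite (_ : (fun z => _) = fy)//; apply/funext => z; case: (dy z).
Qed.

(** Together with [is_CkS], this trades the operators ['D_v], whose values are
    awkward to compute, for explicit derivatives, which class inference
    finds. *)
Lemma is_Ck_derive k f : is_Ck k.+1 f -> exists fx fy,
  [/\ (forall z : R * R, is_derive z (e_x R) f (fx z)),
      (forall z : R * R, is_derive z (e_y R) f (fy z)),
      is_Ck k fx & is_Ck k fy].
Proof.
case=> _ [dx dy Cx Cy].
exists ('D_(e_x R) f), ('D_(e_y R) f).
by split=> // z; exact: DeriveDef.
Qed.

Lemma is_Ck_pred k f : is_Ck k.+1 f -> is_Ck k f.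
Proof.
elim: k f => [|k IH] f Cf; first by split=> //; exact: is_Ck_cont Cf.
have [fx [fy [dx dy Cx Cy]]] := is_Ck_derive Cf.
by apply: is_CkS dx dy _ _; [exact: is_Ck_cont Cf|exact: IH|exact: IH].
Qed.

Lemma is_Ck_cst k (c : R) : is_Ck k (fun=> c).
Proof.
elim: k c => [|k IH] c; first by split => //; exact: cst_continuous.
by apply: (@is_CkS _ _ (fun=> 0) (fun=> 0)) => //; exact: cst_continuous.
Qed.

Lemma is_CkD k f g : is_Ck k f -> is_Ck k g -> is_Ck k (fun z => f z + g z).
Proof.
elim: k f g => [|k IH] f g Cf Cg.
  split=> // z; apply: (@continuousD R R^o _ f g z).
    exact: (is_Ck_cont Cf).
  exact: (is_Ck_cont Cg).
have [fx [fy [dfx dfy Cfx Cfy]]] := is_Ck_derive Cf.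
have [gx [gy [dgx dgy Cgx Cgy]]] := is_Ck_derive Cg.
apply: (@is_CkS _ _ (fun z => fx z + gx z) (fun z => fy z + gy z)).
- move=> z; apply: (@continuousD R R^o _ f g z).
    exact: (is_Ck_cont Cf).
  exact: (is_Ck_cont Cg).
- exact: (IH fx gx).
- exact: (IH fy gy).
Qed.

Lemma is_CkM k f g : is_Ck k f -> is_Ck k g -> is_Ck k (fun z => f z * g z).
Proof.
elim: k f g => [|k IH] f g Cf Cg.
  split=> // z; apply: (@continuousM R _ f g z).
    exact: (is_Ck_cont Cf).
  exact: (is_Ck_cont Cg).
have [fx [fy [dfx dfy Cfx Cfy]]] := is_Ck_derive Cf.
have [gx [gy [dgx dgy Cgx Cgy]]] := is_Ck_derive Cg.
apply: (@is_CkS _ _ (fun z => f z * gx z + g z * fx z)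
                    (fun z => f z * gy z + g z * fy z)).
- move=> z; apply: (@continuousM R _ f g z).
    exact: (is_Ck_cont Cf).
  exact: (is_Ck_cont Cg).
- by apply: is_CkD; apply: IH => //; exact: is_Ck_pred.
- by apply: is_CkD; apply: IH => //; exact: is_Ck_pred.
Qed.

Lemma is_CkN k f : is_Ck k f -> is_Ck k (fun z => - f z).
Proof.
move=> Cf; have := is_CkM (is_Ck_cst k (-1)) Cf.
by congr is_Ck; apply/funext => z; rewrite mulN1r.
Qed.

Lemma is_CkV k f : (forall z, f z != 0) -> is_Ck k f ->
  is_Ck k (fun z => (f z)^-1).
Proof.
move=> f0; elim: k => [|k IH] Cf.
  split=> // z; apply: (@cvgV R _ (nbhs z) _ f (f z)) => //.
  exact: (is_Ck_cont Cf).
have [fx [fy [dfx dfy Cfx Cfy]]] := is_Ck_derive Cf.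
have CV := IH (is_Ck_pred Cf).
have derV (z v : R * R) d : is_derive z v f d ->
    is_derive z v (fun y => (f y)^-1) (- 1 * ((f z)^-1 * (f z)^-1) * d).
  move=> [df <-]; apply: DeriveDef; first exact: derivableV.
  by rewrite deriveV// mulN1r -expr2 -exprVn.
apply: (@is_CkS _ _ (fun z => - 1 * ((f z)^-1 * (f z)^-1) * fx z)
                    (fun z => - 1 * ((f z)^-1 * (f z)^-1) * fy z)).
- move=> z; apply: (@cvgV R _ (nbhs z) _ f (f z)) => //.
  exact: (is_Ck_cont Cf).
- by apply: (is_CkM _ Cfx); apply: is_CkM; [exact: is_Ck_cst|exact: is_CkM].
- by apply: (is_CkM _ Cfy); apply: is_CkM; [exact: is_Ck_cst|exact: is_CkM].
Qed.

(** A directional derivative is the derivative of a function of one variable, so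
    the one-variable chain rule applies to it. *)
Lemma is_derive_line f (z v : R * R) a :
  is_derive z v f a <-> is_derive (0 : R) (1 : R) (fun t => f (t *: v + z)) a.
Proof.
have E : 'D_v f z = 'D_1 (fun t : R => f (t *: v + z)) 0.
  apply: (congr1 (fun F : R -> R => lim (F @ 0^'))); apply/funext => t /=.
  by rewrite scale0r add0r addr0 [_%:A]mulr1.
split=> [[df <-]|[df <-]].
  apply: DeriveDef; last exact: esym E.
  exact: (derivable1P f z v).1.
apply: DeriveDef; last exact: E.
exact: (derivable1P f z v).2.
Qed.

Lemma is_derive_fst (z v : R * R) : is_derive z v fst v.1.
Proof.
apply/is_derive_line.
have /is_derive_eq := is_deriveD
  (is_deriveM (is_derive_id (0 : R) (1 : R))
    (is_derive_cst (v.1 : R) (0 : R) (1 : R)))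
  (is_derive_cst (z.1 : R) (0 : R) (1 : R)).
by apply; rewrite scaler0 add0r addr0 [_%:A]mulr1.
Qed.

Lemma is_derive_snd (z v : R * R) : is_derive z v snd v.2.
Proof.
apply/is_derive_line.
have /is_derive_eq := is_deriveD
  (is_deriveM (is_derive_id (0 : R) (1 : R))
    (is_derive_cst (v.2 : R) (0 : R) (1 : R)))
  (is_derive_cst (z.2 : R) (0 : R) (1 : R)).
by apply; rewrite scaler0 add0r addr0 [_%:A]mulr1.
Qed.

Lemma is_Ck_fst k : is_Ck k (@fst R R).
Proof.
have c : continuous (@fst R R) by move=> z; exact: cvg_fst.
case: k => [|k]; first by [].
apply: (@is_CkS _ _ (fun=> (e_x R).1) (fun=> (e_y R).1)) => //.
- by move=> z; exact: is_derive_fst.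
- by move=> z; exact: is_derive_fst.
- exact: is_Ck_cst.
- exact: is_Ck_cst.
Qed.

Lemma is_Ck_snd k : is_Ck k (@snd R R).
Proof.
have c : continuous (@snd R R) by move=> z; exact: cvg_snd.
case: k => [|k]; first by [].
apply: (@is_CkS _ _ (fun=> (e_x R).2) (fun=> (e_y R).2)) => //.
- by move=> z; exact: is_derive_snd.
- by move=> z; exact: is_derive_snd.
- exact: is_Ck_cst.
- exact: is_Ck_cst.
Qed.

Fixpoint is_Ck1 k h : Prop :=
  if k is k'.+1 then exists2 h' : R -> R,
    (forall t : R, is_derive t 1 h (h' t)) & is_Ck1 k' h'
  else continuous h.

Lemma is_derive1_cont h h' : (forall t : R, is_derive t 1 h (h' t)) ->
  continuous h.
Proof.
move=> d t; apply: differentiable_continuous; apply/derivable1_diffP.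
by case: (d t).
Qed.

Lemma is_Ck1_cont k h : is_Ck1 k h -> continuous h.
Proof. by case: k => // k [h' d _]; exact: is_derive1_cont d. Qed.

Lemma is_derive_comp h f (z v : R * R) a b :
  is_derive (f z) 1 h a -> is_derive z v f b ->
  is_derive z v (fun z => h (f z)) (a * b).
Proof.
move=> dh /is_derive_line df; apply/is_derive_line.
rewrite -[z]add0r -(scale0r v) in dh.
exact: (is_derive1_comp dh df).
Qed.

Lemma is_Ck_comp k h f : is_Ck1 k h -> is_Ck k f -> is_Ck k (fun z => h (f z)).
Proof.
elim: k h f => [|k IH] h f Ch Cf.
  split=> // z; apply: (@continuous_comp _ _ _ f h z).
    exact: (is_Ck_cont Cf).
  exact: Ch.
have [h' dh Ch'] := Ch.
have [fx [fy [dfx dfy Cfx Cfy]]] := is_Ck_derive Cf.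
apply: (@is_CkS _ _ (fun z => h' (f z) * fx z) (fun z => h' (f z) * fy z)).
- move=> z; apply: (@continuous_comp _ _ _ f h z).
    exact: (is_Ck_cont Cf).
  exact: (is_Ck1_cont Ch).
- by move=> z; exact: is_derive_comp.
- by move=> z; exact: is_derive_comp.
- by apply: is_CkM => //; apply: IH => //; exact: is_Ck_pred.
- by apply: is_CkM => //; apply: IH => //; exact: is_Ck_pred.
Qed.

End RealSmooth.

(** * A smooth function flat at the origin *)

Section Flat.
Variable R : realType.
Implicit Types (t : R).

(** The functions [t^-m exp(-1/t)], extended by 0, span a space which is stable
    under derivation; proving all of them differentiable at once is what makes
    [exp(-1/t)] smooth. *)
Definition flat (m : nat) t : R :=
  if 0 < t then t^-1 ^+ m * expR (- t^-1) else 0.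

Lemma flat_le0 m t : t <= 0 -> flat m t = 0.
Proof. by rewrite /flat ltNge => ->. Qed.

Lemma flat_ge0 m t : 0 <= flat m t.
Proof.
rewrite /flat; case: ifP => // t0.
by rewrite mulr_ge0 ?expR_ge0// exprn_ge0// invr_ge0 ltW.
Qed.

Lemma flat_gt0 m t : 0 < t -> 0 < flat m t.
Proof.
move=> t0; rewrite /flat t0.
by rewrite mulr_gt0 ?expR_gt0// exprn_gt0// invr_gt0.
Qed.

(** From [s^(m+2) / (m+2)! <= exp s] at [s = 1/t]. A quadratic bound is what the
    difference quotient at 0 needs. *)
Lemma flat_le_sqr m t : flat m t <= (m.+2)`!%:R * t ^+ 2.
Proof.
have [t0|t0] := ltP 0 t; last by rewrite flat_le0// mulr_ge0// sqr_ge0.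
rewrite /flat t0 expRN ler_pdivrMr ?expR_gt0//.
have s0 : 0 <= t^-1 by rewrite invr_ge0 ltW.
have fact0 : 0 < (m.+2)`!%:R :> R by rewrite ltr0n fact_gt0.
apply: (@le_trans _ _ ((m.+2)`!%:R * t ^+ 2 * (t^-1 ^+ m.+2 / (m.+2)`!%:R))).
  rewrite [_%:R * t ^+ 2]mulrC mulrACA mulfV ?gt_eqF// mulr1.
  rewrite -(add2n m) exprD mulrA -exprMn mulfV ?gt_eqF//.
  by rewrite expr1n mul1r.
apply: ler_wpM2l; first by rewrite mulr_ge0 ?sqr_ge0 ?ltW.
by apply: le_trans (expR_ge1Dxn m.+1 s0); rewrite lerDr.
Qed.

(** The derivative produced by the product rule at [t > 0], with [s = 1/t] and
    [e = exp(-1/t)]. *)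
Lemma flat_derivE m (s e : R) :
  s ^+ m * (e * - (- s ^+ 2 * 1)) + e * (m%:R * s ^+ m.-1 * (- s ^+ 2 * 1)) =
  s ^+ m.+2 * e - m%:R * (s ^+ m.+1 * e).
Proof. by case: m => [|m] /=; rewrite !exprS; ring. Qed.

Lemma is_derive_flat m t :
  is_derive t 1 (flat m) (flat m.+2 t - m%:R * flat m.+1 t).
Proof.
have [t0|t0|t0] := ltgtP t 0.
- rewrite !flat_le0 ?ltW// mulr0 subr0.
  apply: (@near_eq_is_derive _ _ _ (cst 0)).
  near=> s; rewrite flat_le0//; apply: ltW; near: s; exact: lt_nbhsl.
- rewrite /flat t0.
  apply: (@near_eq_is_derive _ _ _
    ((fun s => s^-1) ^+ m * (expR \o (fun s => - s^-1)))).
    near=> s; have -> : 0 < s by near: s; exact: lt_nbhsr.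
    by rewrite !fctE.
  have dV : is_derive t (1:R) (fun s : R => s^-1) (- t ^- 2 *: 1).
    by apply: (@is_deriveV _ id); rewrite ?gt_eqF.
  have dN : is_derive t (1:R) (fun s : R => - s^-1) (- (- t ^- 2 *: 1)).
    exact: (is_deriveN dV).
  have dE := @is_derive1_comp R expR (fun s => - s^-1) t _ _
    (is_derive_expR (- t^-1)) dN.
  have dX := is_deriveX m dV.
  have /is_derive_eq := is_deriveM dX dE.
  apply; rewrite !fctE /= -!exprVn /GRing.scale /=.
  exact: flat_derivE.
- rewrite t0 !flat_le0 ?lexx// mulr0 subr0.
  have L :
      h^-1 *: (flat m (h *: 1 + 0) - flat m 0) @[h --> (0 : R)^'] --> (0 : R).
    apply/cvgr0Pnorm_le => e e0.
    near=> h.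
    have h0 : h != 0 by near: h; exact: nbhs_dnbhs_neq.
    rewrite addr0 [_%:A]mulr1 (flat_le0 m (lexx 0)) subr0.
    rewrite normrM normfV ler_pdivrMl ?normr_gt0// (ger0_norm (flat_ge0 _ _)).
    apply: (le_trans (flat_le_sqr _ _)).
    rewrite -real_normK ?num_real// expr2 mulrCA ler_pM2l ?normr_gt0//.
    rewrite -ler_pdivlMl ?ltr0n ?fact_gt0//.
    near: h; apply: dnbhs0_le.
    by rewrite mulr_gt0// invr_gt0 ltr0n fact_gt0.
  apply: DeriveDef; first by apply/cvg_ex; exists 0.
  exact: cvg_lim.
Unshelve. all: by end_near. Qed.

Lemma is_Ck1D k (f g : R -> R) : is_Ck1 k f -> is_Ck1 k g ->
  is_Ck1 k (fun t => f t + g t).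
Proof.
elim: k f g => [|k IH] f g Cf Cg.
  by move=> t; apply: (@continuousD R R^o _ f g t); [exact: Cf|exact: Cg].
have [f' df Cf'] := Cf; have [g' dg Cg'] := Cg.
exists (fun t => f' t + g' t); last exact: (IH f' g').
by move=> t; exact: is_deriveD.
Qed.

Lemma is_Ck1Z k (c : R) (f : R -> R) :
  is_Ck1 k f -> is_Ck1 k (fun t => c * f t).
Proof.
elim: k f => [|k IH] f Cf.
  by move=> t; apply: (@continuousM R _ (fun=> c) f t);
    [exact: cst_continuous|exact: Cf].
have [f' df Cf'] := Cf.
exists (fun t => c * f' t); last exact: (IH f').
by move=> t; exact: is_deriveZ.
Qed.

Lemma is_Ck1_flat k m : is_Ck1 k (flat m).
Proof.
elim: k m => [|k IH] m; first exact: is_derive1_cont (is_derive_flat m).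
exists (fun t => flat m.+2 t - m%:R * flat m.+1 t) => [t|].
  exact: is_derive_flat.
have := is_Ck1D (IH m.+2) (is_Ck1Z (- m%:R) (IH m.+1)).
by congr is_Ck1; apply/funext => t; rewrite mulNr.
Qed.

End Flat.

(** * Smooth cutoff functions *)

Section Cutoff.
Variable R : realType.
Implicit Types (f g : R * R -> R) (z : R * R).

Definition rsmooth f := forall k, is_Ck k f.

(** The bounds by 0 and 1 make [1 - f] nonnegative, so that joining plateau
    functions by [f + g (1 - f)] can only increase them. *)
Definition plateau f := rsmooth f /\ forall z, 0 <= f z <= 1.

(** [a / (a + b)], with [a] positive where [q < 2] and [b] positive where
    [q > 1], is 1 for [q <= 1] and 0 for [q >= 2]; [q] is the squared distance
    to [z0], scaled so that [q <= 2] stays inside the given ball. *)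
Lemma bump z0 (V : set (R * R)) : open V -> V z0 ->
  exists f, [/\ plateau f, \forall z \near z0, f z = 1 &
    closure [set z | f z != 0] `<=` V].
Proof.
move=> oV Vz0.
have [r/= r0 rV] : nbhs_ball z0 V by apply/nbhs_ballP/open_nbhs_nbhs.
pose q z := ((z.1 - z0.1) ^+ 2 + (z.2 - z0.2) ^+ 2) * ((r / 2) ^- 2).
have q_smooth : rsmooth q.
  move=> k; have cst c := @is_Ck_cst R k c.
  have fst := is_CkD (@is_Ck_fst R k) (cst (- z0.1)).
  have snd := is_CkD (@is_Ck_snd R k) (cst (- z0.2)).
  exact: is_CkM (is_CkD (is_CkM fst fst) (is_CkM snd snd)) (cst _).
pose a z := flat 0 (2 - q z).
pose b z := flat 0 (q z - 1).
have a_smooth : rsmooth a.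
  move=> k; rewrite /a; apply: (is_Ck_comp (is_Ck1_flat R k 0)).
  have := is_CkD (@is_Ck_cst R k 2) (is_CkM (@is_Ck_cst R k (-1)) (q_smooth k)).
  by congr is_Ck; apply/funext => z; rewrite mulN1r.
have b_smooth : rsmooth b.
  move=> k; rewrite /b; apply: (is_Ck_comp (is_Ck1_flat R k 0)).
  exact: is_CkD (q_smooth k) (@is_Ck_cst R k (-1)).
have ab0 z : 0 < a z + b z.
  have [q1|q1] := leP (q z) 1.
    by rewrite ltr_wpDr ?flat_ge0// flat_gt0// subr_gt0 (le_lt_trans q1)// ltr1n.
  by rewrite ltr_wpDl ?flat_ge0// flat_gt0// subr_gt0.
pose f z := a z * (a z + b z)^-1.
have q_cont : continuous q by exact: (is_Ck_cont (q_smooth 0)).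
exists f; split.
- split=> [k|z].
    apply: is_CkM => //; apply: is_CkV; first by move=> z; rewrite gt_eqF.
    exact: is_CkD.
  rewrite /f ler_pdivrMr// mul1r lerDl flat_ge0 andbT.
  by rewrite divr_ge0 ?flat_ge0// ltW.
- have : \forall z \near z0, q z < 1.
    apply: (q_cont z0 [set t | t < 1]); apply: lt_nbhsl.
    by rewrite /q !subrr expr0n /= addr0 mul0r.
  apply: filterS => z q1; rewrite /f /b (flat_le0 _ (t := _ - 1)).
    rewrite addr0 mulfV// gt_eqF// flat_gt0// subr_gt0.
    by rewrite (lt_trans q1)// ltr1n.
  by rewrite subr_le0 ltW.
- have cl : closed [set z | q z <= 2].
    by apply: (@preimage_closed _ _ q [set t | t <= 2]) => //; exact: closed_le.
  apply: (@subset_trans _ [set z | q z <= 2]).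
    rewrite [X in _ `<=` X](closure_id _).1//; apply: closure_subset => z /=.
    apply: contra_neqT; rewrite -ltNge => q2.
    by rewrite /f /a flat_le0 ?mul0r// subr_le0 ltW.
  move=> z /= q2; apply: rV.
  have r20 : 0 < (r / 2) ^+ 2 by rewrite exprn_gt0// divr_gt0.
  move: q2; rewrite /q ler_pdivrMr// => q2.
  have sq t : t ^+ 2 <= 2 * (r / 2) ^+ 2 -> `|t| < r.
    move=> t2; rewrite -(ltr_pXn2r (n := 2)) ?nnegrE ?normr_ge0 ?ltW//.
    by rewrite real_normK ?num_real//; nra.
  split; rewrite /ball/= distrC; apply: sq; apply: le_trans q2.
    by rewrite lerDl sqr_ge0.
  by rewrite lerDr sqr_ge0.
Qed.

Lemma plateauU f g : plateau f -> plateau g ->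
  plateau (fun z => f z + g z * (1 - f z)).
Proof.
move=> [sf f01] [sg g01]; split=> [k|z].
  apply: is_CkD => //; apply: is_CkM => //.
  have := is_CkD (@is_Ck_cst R k 1) (is_CkM (@is_Ck_cst R k (-1)) (sf k)).
  by congr is_Ck; apply/funext => z; rewrite mulN1r.
by have /andP[? ?] := f01 z; have /andP[? ?] := g01 z; apply/andP; split; nra.
Qed.

(** Compactness for plateau functions: a property [Q] which survives the join
    [f + g (1 - f) = 1 - (1 - f) (1 - g)], and which can be met by a function
    equal to 1 near each point of [K], can be met by a function equal to 1 near
    the whole of [K]. Used with [Q] a bound on supports, this gives cutoffs;
    used with [Q] the vanishing of [w] on multiples of [f], it replaces
    partitions of unity. *)
Lemma plateau_cover (Q : (R * R -> R) -> Prop) (K : set (R * R)) :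
  compact K -> Q (fun=> 0) ->
  (forall f g, plateau f -> plateau g -> Q f -> Q g ->
     Q (fun z => f z + g z * (1 - f z))) ->
  (forall z0, K z0 -> exists f, [/\ plateau f, Q f &
     \forall z \near z0, f z = 1]) ->
  exists f, [/\ plateau f, Q f &
    exists U, [/\ open U, K `<=` U & forall z, U z -> f z = 1]].
Proof.
move=> /compact_near_coveringP cK Q0 QU loc.
pose good f := plateau f /\ Q f.
(* The filter of properties shared by all sufficiently large good functions;
   the join makes good functions directed. *)
pose F : set_system (R * R -> R) := [set P | exists f0, good f0 /\
  forall f, good f -> (forall z, f0 z <= f z) -> P f].
have FF : Filter F.
  split.
  - exists (fun=> 0); split=> //; split=> //.
    by split=> [k|z]; [exact: is_Ck_cst|rewrite lexx ler01].
  - move=> P P' [f [[pf Qf] fP]] [g [[pg Qg] gP']].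
    exists (fun z => f z + g z * (1 - f z)); split.
      by split; [exact: plateauU|exact: QU].
    move=> h gh fgh; split; [apply: fP|apply: gP'] => // z;
      apply: le_trans (fgh z); have /andP[? ?] := pf.2 z;
      have /andP[? ?] := pg.2 z; nra.
  - move=> P P' PP' [f [gf fP]]; exists f; split=> // g gg fg.
    exact/PP'/fP.
pose P f z := nbhs z [set z' | f z' = 1].
have [|f [gf fK]] := cK _ F P FF.
  move=> z0 Kz0; have [f [pf Qf f1]] := loc _ Kz0.
  exists ([set z | P f z], [set g | good g /\ forall z, f z <= g z]).
    split; first exact: nbhs_interior.
    by exists f; split.
  move=> [z g] /= [fz [[pg _] fg]]; apply: filterS fz => z' /= f1'.
  by apply/eqP; rewrite eq_le (andP (pg.2 z')).2 -f1' fg.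
have fKf := fK f gf (fun z => lexx _).
exists f; case: gf => pf Qf; split=> //.
exists ([set z | f z = 1]°); split; first exact: open_interior.
  by move=> z /fKf.
by move=> z /interior_subset.
Qed.

Lemma cutoff (K V : set (R * R)) : compact K -> open V -> K `<=` V ->
  exists f, [/\ plateau f, closure [set z | f z != 0] `<=` V &
    exists U, [/\ open U, K `<=` U & forall z, U z -> f z = 1]].
Proof.
move=> cK oV KV.
apply: (@plateau_cover (fun f => closure [set z | f z != 0] `<=` V)) => //.
- rewrite (_ : [set _ | _] = set0) ?closure0//.
  by apply/seteqP; split=> z //=; rewrite eqxx.
- move=> f g _ _ fV gV.
  apply: (@subset_trans _ (closure ([set z | f z != 0] `|` [set z | g z != 0]))).
    apply: closure_subset => z /= fg0.
    have [f0|] := eqVneq (f z) 0; last by left.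
    right; move: fg0; rewrite f0 add0r; apply: contra_neq => ->.
    by rewrite mul0r.
  by rewrite closureU => z [/fV|/gV].
- move=> z0 Kz0; have [f [pf f1 fV]] := bump oV (KV _ Kz0).
  by exists f; split.
Qed.

End Cutoff.

(** * Test functions and linear functionals *)

Section Distr.
Variable R : realType.
Local Notation C := R[i].
Implicit Types (phi f g : R * R -> C) (w : functional R) (K U V : set (R * R)).

Lemma smooth_real (f : R * R -> R) : rsmooth f -> smooth (fun z => (f z)%:C).
Proof. by move=> sf k; split; [exact: sf|exact: is_Ck_cst]. Qed.

Lemma smooth_cst (c : C) : smooth (fun=> c : C).
Proof. by move=> k; split; exact: is_Ck_cst. Qed.

Lemma smoothD f g : smooth f -> smooth g -> smooth (fun z => f z + g z).
Proof.
move=> sf sg k; have [fr fi] := sf k; have [gr gi] := sg k.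
split; [have := is_CkD fr gr|have := is_CkD fi gi]; congr is_Ck;
  by apply/funext => z; case: (f z) (g z) => [a b] [c d].
Qed.

Lemma smoothM f g : smooth f -> smooth g -> smooth (fun z => f z * g z).
Proof.
move=> sf sg k; have [fr fi] := sf k; have [gr gi] := sg k.
split; [have := is_CkD (is_CkM fr gr) (is_CkN (is_CkM fi gi))
       |have := is_CkD (is_CkM fr gi) (is_CkM fi gr)]; congr is_Ck;
  by apply/funext => z; case: (f z) (g z) => [a b] [c d].
Qed.

Lemma smooth_conj f : smooth f -> smooth (fun z => (f z)^*).
Proof.
move=> sf k; have [fr fi] := sf k.
split; [have := fr|have := is_CkN fi]; congr is_Ck;
  by apply/funext => z; case: (f z).
Qed.

Lemma smooth_sum (I : Type) (s : seq I) (P : pred I) (F : I -> R * R -> C) :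
  (forall i, smooth (F i)) -> smooth (fun z => \sum_(i <- s | P i) F i z).
Proof.
move=> sF; elim: s => [|i s IH].
  rewrite (_ : (fun z => _) = fun=> 0); first exact: smooth_cst.
  by apply/funext => z; rewrite big_nil.
case Pi: (P i).
  rewrite (_ : (fun z => _) = fun z => F i z + \sum_(i <- s | P i) F i z).
    exact: smoothD.
  by apply/funext => z; rewrite big_cons Pi.
rewrite (_ : (fun z => _) = fun z => \sum_(i <- s | P i) F i z)//.
by apply/funext => z; rewrite big_cons Pi.
Qed.

Lemma smooth_horner (q : {poly C}) f : smooth f -> smooth (fun z => q.[f z]).
Proof.
move=> sf; elim/poly_ind: q => [|q c IH].
  rewrite (_ : (fun z => _) = fun=> 0); first exact: smooth_cst.
  by apply/funext => z; rewrite horner0.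
rewrite (_ : (fun z => _) = fun z => q.[f z] * f z + c).
  by apply: smoothD; [exact: smoothM|exact: smooth_cst].
by apply/funext => z; rewrite hornerMXaddC.
Qed.

Lemma smooth_fst : smooth (fun z : R * R => z.1%:C).
Proof. by apply: smooth_real => k; exact: is_Ck_fst. Qed.

Lemma smooth_snd : smooth (fun z : R * R => z.2%:C).
Proof. by apply: smooth_real => k; exact: is_Ck_snd. Qed.

Lemma test_mul phi f : test_function phi -> smooth f ->
  test_function (fun z => phi z * f z).
Proof.
move=> [sphi cphi] sf; split; first exact: smoothM.
apply: (subclosed_compact _ cphi); first exact: closed_closure.
by apply: closure_subset => z /=; apply: contra_neq => ->; rewrite mul0r.
Qed.

Lemma test_lin (a : C) phi f : test_function phi -> test_function f ->
  test_function (fun z => a * phi z + f z).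
Proof.
move=> [sphi cphi] [sf cf]; split.
  by apply: smoothD => //; apply: smoothM => //; exact: smooth_cst.
apply: (subclosed_compact _ (compactU cphi cf)); first exact: closed_closure.
rewrite -closureU; apply: closure_subset => z /=.
have [->|] := eqVneq (phi z) 0; last by left.
by rewrite mulr0 add0r; right.
Qed.

Lemma test0 : test_function (fun=> 0 : C).
Proof.
split; first exact: smooth_cst.
rewrite /tsupp (_ : [set _ | _] = set0) ?closure0; first exact: compact0.
by apply/seteqP; split=> z //=; rewrite eqxx.
Qed.

Lemma testD phi f : test_function phi -> test_function f ->
  test_function (fun z => phi z + f z).
Proof.
move=> tp tf; have := test_lin 1 tp tf; congr test_function.
by apply/funext => z; rewrite mul1r.
Qed.

Lemma test_sum (I : Type) (s : seq I) (F : I -> R * R -> C) :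
  (forall i, test_function (F i)) ->
  test_function (fun z => \sum_(i <- s) F i z).
Proof.
move=> tF; elim: s => [|i s IH].
  have := test0; congr test_function.
  by apply/funext => z; rewrite big_nil.
have := testD (tF i) IH; congr test_function.
by apply/funext => z; rewrite big_cons.
Qed.

Definition linear_functional w := forall (a : C) phi f,
  test_function phi -> test_function f ->
  w (fun z => a * phi z + f z) = a * w phi + w f.

Section Linear.
Variable w : functional R.
Hypothesis lw : linear_functional w.

Lemma functional0 : w (fun=> 0) = 0.
Proof.
have e : (fun _ : R * R => 1 * 0 + 0 : C) = fun=> 0.
  by apply/funext => z; rewrite mul1r addr0.
have := lw 1 test0 test0; rewrite e mul1r.
by move/(congr1 (fun c => c - w (fun=> 0))); rewrite addrK subrr.
Qed.

Lemma functionalD phi f : test_function phi -> test_function f ->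
  w (fun z => phi z + f z) = w phi + w f.
Proof.
move=> tp tf; rewrite -[w phi]mul1r -lw//; congr w.
by apply/funext => z; rewrite mul1r.
Qed.

Lemma functionalZ a phi : test_function phi ->
  w (fun z => a * phi z) = a * w phi.
Proof.
move=> tp; rewrite -[RHS]addr0 -functional0 -lw//; last exact: test0.
by congr w; apply/funext => z; rewrite addr0.
Qed.

Lemma functional_sum (I : Type) (s : seq I) (F : I -> R * R -> C) :
  (forall i, test_function (F i)) ->
  w (fun z => \sum_(i <- s) F i z) = \sum_(i <- s) w (F i).
Proof.
move=> tF; elim: s => [|i s IH].
  rewrite big_nil -[RHS]functional0; congr w.
  by apply/funext => z; rewrite big_nil.
rewrite big_cons -IH -functionalD//; last exact: test_sum.
by congr w; apply/funext => z; rewrite big_cons.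
Qed.

(** Off the support of [w], every point has a bump [f] such that [w] kills all
    multiples of [f]. Gluing these bumps over the support of [g] yields an [f]
    equal to 1 there, and [g = g f]. *)
Lemma functional_local g U : test_function g -> open U -> dsupp w `<=` U ->
  (forall z, U z -> g z = 0) -> w g = 0.
Proof.
move=> tg oU wU gU; have [sg cg] := tg.
have [] := @plateau_cover _ (fun f : R * R -> R => forall h, test_function h ->
  w (fun z => h z * (f z)%:C) = 0) _ cg.
- move=> h th; rewrite (_ : (fun z => _) = fun=> 0) ?functional0//.
  by apply/funext => z; rewrite mulr0.
- move=> f1 f2 [sf1 _] [sf2 _] Q1 Q2 h th.
  have t1 := test_mul th (smooth_real sf1).
  have t2 := test_mul th (smooth_real sf2).
  have := test_mul t1 (smooth_real sf2) => t12.
  transitivity (w (fun z => h z * (f1 z)%:C +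
     (h z * (f2 z)%:C + -1 * (h z * (f1 z)%:C * (f2 z)%:C)))).
    congr w; apply/funext => z.
    by rewrite raddfD /= rmorphM raddfB /=; ring.
  have tN : test_function (fun z => -1 * (h z * (f1 z)%:C * (f2 z)%:C)).
    have := test_lin (-1) t12 test0; congr test_function.
    by apply/funext => z; rewrite addr0.
  rewrite functionalD//; last exact: testD.
  by rewrite functionalD// functionalZ// Q1// Q2// Q2// mulr0 !addr0.
- move=> z0 gz0.
  have nUz0 : ~ dsupp w z0.
    move=> /wU Uz0; have := gz0 U (open_nbhs_nbhs (conj oU Uz0)).
    by move=> [z [/= /eqP gz0' /gU]].
  have [V [oV Vz0 wV]] : exists V, [/\ open V, V z0 & vanishes_on w V].
    apply: contrapT => nV; apply: nUz0 => V oV Vz0 wV; apply: nV.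
    by exists V.
  have [f [pf f1 fV]] := bump oV Vz0.
  exists f; split=> // h th; apply: wV; first exact: test_mul (smooth_real pf.1).
  apply: subset_trans fV; apply: closure_subset => z /=.
  by apply: contra_neq => ->; rewrite mulr0.
- move=> f [_ Qf [V [_ gV f1]]].
  rewrite -[RHS](Qf g tg); congr w; apply/funext => z.
  have [->|gz] := eqVneq (g z) 0; first by rewrite mul0r.
  by rewrite f1 ?mulr1//; apply/gV/subset_closure.
Qed.

(** The value of the pairing is independent of the test function chosen to
    extend [f], because two choices differ by a function that vanishes near the
    support. *)
Lemma pairing_eq f g U : test_function g -> open U -> dsupp w `<=` U ->
  (forall z, U z -> g z = f z) -> pairing w f = w g.
Proof.
move=> tg oU wU gf; rewrite /pairing.
case: xgetP => [c cE [h [th [V [oV wV hf]] ch]]|]; last first.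
  by move=> /(_ (w g)) []; exists g; split=> //; exists U.
rewrite ch; apply/eqP; rewrite -subr_eq0; apply/eqP.
transitivity (w (fun z => -1 * g z + h z)).
  by rewrite lw// mulN1r addrC.
apply: (functional_local (test_lin _ tg th) (openI oU oV)).
  by move=> z wz; split; [exact: wU|exact: wV].
by move=> z [Uz Vz]; rewrite gf// hf// mulN1r addNr.
Qed.

End Linear.
End Distr.

(** * The perturbed kernel *)

Section Kernel.
Variables (R : realType) (p : nat).
Local Notation C := R[i].
Implicit Types (u v : 'M[functional R]_p) (W F G : 'M[{poly C}]_p).
Implicit Types (w : functional R).

Definition box (M : R) : set (R * R) := `[- M, M] `*` `[- M, M].

Lemma box_compact M : compact (box M).
Proof. by apply: compact_setX; exact: segment_compact. Qed.

Lemma box_closed M : closed (box M).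
Proof.
have c1 : continuous (@fst R R) by move=> z; exact: cvg_fst.
have c2 : continuous (@snd R R) by move=> z; exact: cvg_snd.
by apply: closedI; apply: preimage_closed => //; exact: itv_closed.
Qed.

Lemma dsupp_closed w : closed (dsupp w).
Proof.
rewrite -openC openE => z /= nwz.
have [U [oU Uz wU]] : exists U, [/\ open U, U z & vanishes_on w U].
  by apply: contrapT => nU; apply: nwz => U oU Uz wU; apply: nU; exists U.
apply: filterS (open_nbhs_nbhs (conj oU Uz)) => z' Uz' /= wz'.
exact: (wz' U).
Qed.

Lemma box_cutoff (M : R) : exists chi : R * R -> C, test_function chi /\
  exists U, [/\ open U, box M `<=` U & forall z, U z -> chi z = 1].
Proof.
pose V : set (R * R) := `](- (M + 1)), (M + 1)[ `*` `](- (M + 1)), (M + 1)[.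
have oV : open V.
  have c1 : continuous (@fst R R) by move=> z; exact: cvg_fst.
  have c2 : continuous (@snd R R) by move=> z; exact: cvg_snd.
  by apply: openI; apply: open_comp => //; exact: itv_open.
have [|f [[sf _] fV [U [oU KU f1]]]] := cutoff (@box_compact M) oV.
  move=> [x y] [] /=; rewrite !in_itv /= => /andP[? ?] /andP[? ?].
  by split; rewrite /= in_itv /=; apply/andP; split; lra.
exists (fun z => (f z)%:C); split; last first.
  by exists U; split=> // z /f1 ->.
split; first exact: smooth_real.
apply: (subclosed_compact _ (@box_compact (M + 1))); first exact: closed_closure.
apply: (@subset_trans _ V).
  apply: subset_trans fV; apply: closure_subset => z /=.
  by apply: contra_neq => ->.
move=> [x y] [] /=; rewrite !in_itv /= => /andP[? ?] /andP[? ?].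
by split; rewrite /= in_itv /=; apply/andP; split; apply: ltW.
Qed.

(** Globally smooth functions that agree near the support of [w] with the entries
    of a row of [W(y)^-1]. By Cramer's rule the inverse is
    [adj W * conj (det W) / |det W|^2]; adding [1 - f] to the denominator, with
    [f] a cutoff supported off the zeros of [det W] and equal to 1 near the
    support of [w], makes it nowhere zero without changing it there. *)
Lemma inv_smooth w W (m : 'I_p) : compact (dsupp w) ->
  (forall z, dsupp w z -> rmeval W z.2 \in unitmx) ->
  exists (Inv : 'I_p -> R * R -> C) U, [/\ open U, dsupp w `<=` U,
    (forall l, smooth (Inv l)) & forall z, U z ->
      rmeval W z.2 \in unitmx /\ forall l, Inv l z = invmx (rmeval W z.2) m l].
Proof.
move=> cw Wu.
pose d (z : R * R) : C := (\det W).[z.2%:C].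
have detE z : \det (rmeval W z.2) = d z.
  by rewrite /rmeval /meval -[RHS]/(horner_eval _ _) -det_map_mx.
have adjE z l : (\adj (rmeval W z.2)) m l = (\adj W m l).[z.2%:C].
  rewrite /rmeval /meval -[RHS]/(horner_eval _ _).
  by rewrite -(map_mx_adj (horner_eval z.2%:C)) mxE.
have sd : smooth d by apply: smooth_horner; exact: smooth_snd.
pose q z :=
  complex.Re (d z) * complex.Re (d z) + complex.Im (d z) * complex.Im (d z).
have sq : rsmooth q.
  by move=> k; have [? ?] := sd k; apply: is_CkD; exact: is_CkM.
have qE z : d z * (d z)^* = (q z)%:C.
  rewrite /q; case: (d z) => a b /=; apply/eqP; rewrite eq_complex /=.
  by apply/andP; split; apply/eqP; ring.
have q_ge0 z : 0 <= q z by rewrite /q -!expr2 addr_ge0// sqr_ge0.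
have q_eq0 z : (q z == 0) = (d z == 0).
  apply/eqP/eqP => [q0|d0].
    have := qE z; rewrite q0 => /eqP; rewrite mulf_eq0 conjc_eq0 orbb.
    by move/eqP.
  by rewrite /q d0 /= mulr0 addr0.
pose V := [set z | q z != 0].
have oV : open V.
  apply: (@open_comp _ _ q [set t | t != 0]); last exact: open_neq.
  by move=> z _; exact: (is_Ck_cont (sq 0)).
have [|f [[sf f01] fV [U [oU KU f1]]]] := cutoff cw oV.
  by move=> z /Wu; rewrite unitmxE unitfE detE /V /= q_eq0.
pose den z := q z + (1 - f z).
have den0 z : den z != 0.
  have [qz|qz] := eqVneq (q z) 0; last first.
    rewrite gt_eqF// ltr_wpDr// ?subr_ge0 ?(andP (f01 z)).2//.
    by rewrite lt_def qz q_ge0.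
  have fz : f z = 0.
    apply: contrapT => /eqP fz; have := fV z (@subset_closure _ _ z fz).
    by rewrite /V /= qz eqxx.
  by rewrite /den qz fz subr0 add0r oner_neq0.
have sden : rsmooth (fun z => (den z)^-1).
  move=> k; apply: is_CkV => //; apply: is_CkD => //.
  exact: is_CkD (@is_Ck_cst R k 1) (is_CkN (sf k)).
exists (fun l z => (\adj W m l).[z.2%:C] * ((d z)^* * ((den z)^-1)%:C)), U.
split=> // [l|z Uz].
  apply: smoothM; first by apply: smooth_horner; exact: smooth_snd.
  by apply: smoothM; [exact: smooth_conj|exact: smooth_real].
have dz : d z != 0.
  by rewrite -q_eq0; apply: (fV z); apply: subset_closure;
    rewrite /= f1// oner_neq0.
have Wz : rmeval W z.2 \in unitmx by rewrite unitmxE unitfE detE.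
split=> // l; rewrite /invmx Wz [RHS]mxE adjE detE mulrC; congr (_ * _).
rewrite /den f1// subrr addr0 fmorphV /= -qE invfM mulrCA mulfV ?mulr1//.
by rewrite conjc_eq0.
Qed.

(** What the pairing of a kernel with smooth functions needs. The bound [M] is a
    parameter, so that one cutoff serves several kernels. *)
Record tame u (M : R) : Prop := Tame {
  tame_linear : forall k l, linear_functional (u k l);
  tame_supp : forall k l, dsupp (u k l) `<=` box M }.

Lemma generalized_tame u : generalized_kernel u ->
  exists M0, forall M, M0 <= M -> tame u M.
Proof.
move=> [fu [Mx [_ bx]] [My [_ byy]]].
exists (Num.max Mx My + 1) => M; rewrite -lerBrDr ge_max => /andP[xM yM].
split=> k l; first by have [[]] := fu k l.
move=> [x y] wz.
have ltM t : t <= M - 1 -> t < M by move=> ?; lra.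
have := bx M (ltM _ xM) x (ex_intro _ k (ex_intro _ l (ex_intro _ y wz))).
have := byy M (ltM _ yM) y (ex_intro _ k (ex_intro _ l (ex_intro _ x wz))).
by move=> /= ? ?; split; rewrite /= in_itv /= -ler_norml.
Qed.

Lemma tame_compact u M k l : tame u M -> compact (dsupp (u k l)).
Proof.
move=> tu; apply: (subclosed_compact _ (@box_compact M)).
  exact: dsupp_closed.
exact: tame_supp.
Qed.

(** A single cutoff turns all the pairings into evaluations on test functions,
    and so transports linearity to them. *)
Lemma tame_pairing M : exists chi : R * R -> C, test_function chi /\
  forall u k l, tame u M ->
  forall f, smooth f -> pairing (u k l) f = u k l (fun z => chi z * f z).
Proof.
have [chi [tchi [U [oU KU chi1]]]] := box_cutoff M.
exists chi; split=> // u k l tu f sf.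
apply: (pairing_eq (tame_linear tu k l) (test_mul tchi sf) oU).
  by move=> z0 /(tame_supp tu) /KU.
by move=> z /chi1 ->; rewrite mul1r.
Qed.

Section TameForm.
Variables (u : 'M[functional R]_p) (M : R).
Hypothesis tu : tame u M.

Lemma tame_pairing_sum (I : Type) (s : seq I) k l (c : I -> C)
    (f : I -> R * R -> C) : (forall i, smooth (f i)) ->
  pairing (u k l) (fun z => \sum_(i <- s) c i * f i z) =
  \sum_(i <- s) c i * pairing (u k l) (f i).
Proof.
move=> sf; have [chi [tchi chiE]] := tame_pairing M.
have lu := tame_linear tu k l.
have scf i : smooth (fun z => c i * f i z).
  by apply: smoothM => //; exact: smooth_cst.
rewrite chiE//; last exact: smooth_sum.
transitivity (u k l (fun z => \sum_(i <- s) c i * (chi z * f i z))).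
  congr (u k l); apply/funext => z; rewrite mulr_sumr.
  by apply: eq_bigr => i _; rewrite mulrCA.
rewrite functional_sum//; last first.
  move=> i; have := test_mul tchi (scf i); congr test_function.
  by apply/funext => z; rewrite mulrCA.
apply: eq_bigr => i _; rewrite functionalZ ?chiE//.
exact: test_mul.
Qed.

End TameForm.

Section Perturbation.
Variables (u v : 'M[functional R]_p) (W : 'M[{poly C}]_p) (M : R).
Hypotheses (tu : tame u M) (tv : tame v M).
Hypothesis Wu : forall k l z, dsupp (u k l) z -> rmeval W z.2 \in unitmx.
Hypothesis vW : null_kernel (mulk v W).

Lemma tame_addk_divk : tame (addk (divk u W) v) M.
Proof.
have inv k m := @inv_smooth (u k m) W m (tame_compact tu) (@Wu k m).
(* The pairings in [divk] are evaluations at smooth multiples of [phi]. *)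
have divE k m l phi : test_function phi ->
    forall Inv U, open U -> dsupp (u k m) `<=` U -> smooth (Inv l) ->
    (forall z, U z -> rmeval W z.2 \in unitmx /\
       forall l, Inv l z = invmx (rmeval W z.2) m l) ->
    pairing (u k m) (fun z => phi z * invmx (rmeval W z.2) m l) =
    u k m (fun z => phi z * Inv l z).
  move=> tphi Inv U oU uU sInv InvE.
  apply: (pairing_eq (tame_linear tu k m) (test_mul tphi sInv) oU uU).
  by move=> z /InvE[_ ->].
split=> k l.
  move=> a phi f tphi tf; rewrite !mxE.
  have -> : v k l (fun z => a * phi z + f z) = a * v k l phi + v k l f.
    exact: (tame_linear tv k l).
  rewrite mulrDr mulr_sumr addrACA -big_split /=; congr (_ + _).
  apply: eq_bigr => m _; have [Inv [U [oU uU sInv InvE]]] := inv k m.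
  rewrite !(divE _ _ _ _ _ Inv U)//; last exact: test_lin.
  rewrite -(tame_linear tu k m); try exact: test_mul.
  by congr (u k m); apply/funext => z; ring.
move=> z; apply: contraPP => nKz wz.
apply: (wz (~` box M)) => //; first exact/closed_openC/box_closed.
move=> phi tphi phiM; rewrite !mxE.
have oU : open (~` tsupp phi) by exact/closed_openC/closed_closure.
have KU : box M `<=` ~` tsupp phi by move=> z' Kz' /phiM.
have phi0 z' : (~` tsupp phi) z' -> phi z' = 0.
  by move=> nz'; apply: contrapT => /eqP ?; apply: nz'; exact: subset_closure.
rewrite (functional_local (tame_linear tv k l) tphi oU)//; last first.
  by move=> z0 /(tame_supp tv) /KU.
rewrite addr0 big1// => m _.
rewrite (pairing_eq (tame_linear tu k m) (test0 R) oU).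
- exact: functional0 (tame_linear tu k m).
- by move=> z0 /(tame_supp tu) /KU.
- by move=> z' /phi0 ->; rewrite mul0r.
Qed.

Lemma smooth_entry1 F i j : smooth (fun z : R * R => rmeval F z.1 i j).
Proof.
rewrite (_ : (fun z => _) = fun z => (F i j).[z.1%:C]).
  by apply: smooth_horner; exact: smooth_fst.
by apply/funext => z; rewrite mxE.
Qed.

Lemma smooth_entry2 F i j : smooth (fun z : R * R => rmeval F z.2 i j).
Proof.
rewrite (_ : (fun z => _) = fun z => (F i j).[z.2%:C]).
  by apply: smooth_horner; exact: smooth_snd.
by apply/funext => z; rewrite mxE.
Qed.

(** Writing out [W^T], the contribution of [v] is a sum of values of the null
    kernel [v W]. In that of [u W^-1], near the support of [u] the products
    [sum_l (W^-1)_{m,l} W_{l,n}] are Kronecker symbols, which leaves exactly the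
    pairing of [u] with [F] and [G]. *)
Lemma form_perturbation F G :
  Defs.form (addk (divk u W) v) (rmeval F) (rmeval (G *m W^T)) =
  Defs.form u (rmeval F) (rmeval G).
Proof.
apply/matrixP => i j; rewrite !mxE; apply: eq_bigr => k _.
have [chi [tchi chiE]] := tame_pairing M.
pose g m z := rmeval F z.1 i k * rmeval G z.2 j m.
have sg m : smooth (g m).
  by apply: smoothM; [exact: smooth_entry1|exact: smooth_entry2].
pose psi m z := chi z * g m z.
have tpsi m : test_function (psi m) by exact: test_mul.
pose phi l z := \sum_m psi m z * rmeval W z.2 l m.
have GWE z l : rmeval (G *m W^T) z j l = \sum_m rmeval G z j m * rmeval W z l m.
  rewrite !mxE horner_sum; apply: eq_bigr => m _.
  by rewrite !mxE hornerM.
have sW l m : smooth (fun z : R * R => rmeval W z.2 l m) by exact: smooth_entry2.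
have tphi l : test_function (phi l).
  have := test_mul tchi (smooth_sum (index_enum _) xpredT
    (fun m => smoothM (sg m) (sW l m))).
  congr test_function; apply/funext => z; rewrite mulr_sumr.
  by apply: eq_bigr => m _; rewrite mulrA.
transitivity (\sum_l (addk (divk u W) v) k l (phi l)).
  apply: eq_bigr => l _; rewrite (chiE _ k l tame_addk_divk); last first.
    by apply: smoothM; [exact: smooth_entry1|exact: smooth_entry2].
  congr (_ _); apply/funext => z; rewrite GWE !mulr_sumr.
  by apply: eq_bigr => m _; rewrite /psi /g !mulrA.
have -> : \sum_l (addk (divk u W) v) k l (phi l) =
    \sum_l \sum_m pairing (u k m) (fun z => phi l z * invmx (rmeval W z.2) m l) +
    \sum_l v k l (phi l).
  by rewrite -big_split; apply: eq_bigr => l _; rewrite !mxE.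
have -> : \sum_l v k l (phi l) = 0.
  transitivity (\sum_l \sum_m v k l (fun z => psi m z * rmeval W z.2 l m)).
    apply: eq_bigr => l _; rewrite (functional_sum (tame_linear tv k l))// => m.
    exact: test_mul.
  rewrite exchange_big big1// => m _.
  by have := @vW k m (psi m) (tpsi m); rewrite mxE.
rewrite addr0 exchange_big; apply: eq_bigr => m _.
have [Inv [U [oU uU sInv InvE]]] :=
  inv_smooth m (tame_compact tu) (@Wu k m).
have lu := tame_linear tu k m.
transitivity (\sum_l u k m (fun z => phi l z * Inv l z)).
  apply: eq_bigr => l _.
  apply: (pairing_eq lu (test_mul (tphi l) (sInv l)) oU uU).
  by move=> z /InvE[_ ->].
rewrite -functional_sum// => [|l]; last exact: test_mul.
rewrite (chiE _ k m tu)//; last exact: sg.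
have tS : test_function (fun z => \sum_l phi l z * Inv l z).
  by apply: test_sum => l; exact: test_mul.
rewrite -(pairing_eq (f := psi m) lu tS oU uU).
  exact: (pairing_eq lu (tpsi m) oU uU).
move=> z /InvE[Wz InvW].
transitivity (\sum_n psi n z * \sum_l invmx (rmeval W z.2) m l * rmeval W z.2 l n).
  rewrite /phi; under eq_bigr do rewrite mulr_suml.
  rewrite exchange_big; apply: eq_bigr => n _; rewrite mulr_sumr.
  by apply: eq_bigr => l _; rewrite InvW; ring.
have VW n : \sum_l invmx (rmeval W z.2) m l * rmeval W z.2 l n = (m == n)%:R.
  by have := congr1 (fun X : 'M[C]_p => X m n) (mulVmx Wz); rewrite !mxE.
under eq_bigr do rewrite VW.
rewrite (bigD1 m)//= eqxx mulr1 big1 ?addr0// => n nm.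
by rewrite eq_sym (negbTE nm) mulr0.
Qed.

End Perturbation.

End Kernel.

(** * Block matrices, matrix polynomials and biorthogonality *)

Section Algebra.
Variables (R : realType) (p : nat).
Local Notation C := R[i].
Local Notation M := 'M[C]_p.
Local Notation MP := 'M[{poly C}]_p.
Local Notation cst := (map_mx polyC).
Implicit Types (F G : MP) (S A : bmx R p).

(** The entries of [chi]: the monomials [I_p x^n]. *)
Definition Xpow (n : nat) : MP := ('X^n)%:M.

(** A left combination with matrix coefficients; [matpoly n a] is one of
    monomials. *)
Definition lsum (n : nat) (c : nat -> M) (F : nat -> MP) : MP :=
  \sum_(i < n) cst (c i) *m F i.

Lemma matpolyE n (a : nat -> M) : matpoly n a = lsum n.+1 a Xpow.
Proof.
by apply: eq_bigr => i _; rewrite /Xpow mul_mx_scalar.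
Qed.

Lemma meval_lsum n c (F : nat -> MP) (z : C) :
  meval (lsum n c F) z = \sum_(i < n) c i *m meval (F i) z.
Proof.
apply/matrixP => j k; rewrite mxE summxE horner_sum [RHS]summxE.
apply: eq_bigr => i _; rewrite !mxE horner_sum; apply: eq_bigr => l _.
by rewrite hornerM !mxE hornerC.
Qed.

Lemma meval_Xpow n z : meval (Xpow n) z = (z ^+ n)%:M.
Proof. by apply/matrixP => j k; rewrite !mxE hornerMn hornerXn. Qed.

Lemma mevalM F G z : meval (F *m G) z = meval F z *m meval G z.
Proof. exact: (map_mxM (horner_eval z)). Qed.

Lemma sum_ltn_widen (V : nmodType) k n (F : nat -> V) : (k <= n)%N ->
  (forall i, (k <= i < n)%N -> F i = 0) -> \sum_(i < n) F i = \sum_(i < k) F i.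
Proof.
move=> kn F0; rewrite -(subnKC kn) big_split_ord /= [X in _ + X]big1 ?addr0//.
by move=> i _; rewrite F0// leq_addr /=; have := ltn_ord i; lia.
Qed.

Definition lower A := forall k l, (k < l)%N -> A k l = 0.

Lemma ltmulE A S n k l : lower A -> (k < n)%N ->
  ltmul A S k l = \sum_(j < n) A k j *m S j l.
Proof.
move=> lA kn; rewrite (@sum_ltn_widen _ k.+1 n (fun j => A k j *m S j l))//.
by move=> i /andP[ki _]; rewrite lA// mul0mx.
Qed.

(** Restricting the inner sum of [ltmul S T] to the indices below the diagonal
    loses nothing because [S] is lower triangular. *)
Lemma ltmulA A S T : lower S -> ltmul A (ltmul S T) = ltmul (ltmul A S) T.
Proof.
move=> lS; apply/funext => n; apply/funext => l; rewrite /ltmul.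
under [RHS]eq_bigr => i _ do rewrite mulmx_suml.
rewrite exchange_big /=; apply: eq_bigr => k _.
under [RHS]eq_bigr => i _ do rewrite -mulmxA.
rewrite -mulmx_sumr; congr (_ *m _).
rewrite [RHS](@sum_ltn_widen _ k.+1 n.+1 (fun i => S k i *m T i l))//.
by move=> i /andP[ki _]; rewrite lS// mul0mx.
Qed.

Lemma ltmul_lower A S : lower S -> lower (ltmul A S).
Proof.
move=> lS k l kl; rewrite /ltmul big1// => j _.
by rewrite lS ?mulmx0// (leq_ltn_trans _ kl)// -ltnS.
Qed.

Lemma ltmul_diagb (D : nat -> M) S k l : ltmul (diagb D) S k l = D k *m S k l.
Proof.
rewrite /ltmul big_ord_recr /= big1 ?add0r; last first.
  by move=> i _; rewrite /diagb gtn_eqF ?mul0mx// ltn_ord.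
by rewrite /diagb eqxx.
Qed.

Lemma ltmul1 S : ltmul (@idb R p) S = S.
Proof.
apply/funext => k; apply/funext => l.
rewrite (_ : idb _ _ = diagb (fun=> 1%:M)) ?ltmul_diagb ?mul1mx//.
Qed.

Lemma mul_mxrow_trunc n (c : nat -> M) A :
  (\mxrow_(i < n) c i) *m trunc A n = \mxrow_(j < n) \sum_(i < n) c i *m A i j.
Proof. by rewrite mul_mxrow_mxblock. Qed.

Lemma trunc_ltmul n A S : lower A ->
  trunc A n *m trunc S n = trunc (ltmul A S) n.
Proof.
move=> lA; rewrite /trunc mul_mxblock; apply: eq_mxblock => i j.
by rewrite (ltmulE _ _ lA (ltn_ord i)).
Qed.

Lemma trunc_idb n : trunc (@idb R p) n = 1%:M.
Proof.
have E m (c : 'I_n -> 'M[C]_(m, p)) :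
    (\mxrow_i c i) *m trunc (@idb R p) n = \mxrow_i c i.
  rewrite mul_mxrow_mxblock; apply: eq_mxrow => j.
  rewrite [LHS](bigD1 j)//= /idb eqxx mulmx1 big1 ?addr0// => i ij.
  by rewrite ifN ?mulmx0.
have := E _ (submxrow 1%:M); rewrite -[\mxrow_i _]/(\mxrow_i submxrow 1%:M i).
by rewrite submxrowK mul1mx.
Qed.

(** The rules obeyed by [G |-> <F, G>], and also by the defect of reproduction
    of a kernel, which is not of that form; the degree count [rfun_mulWT] serves
    both. *)
Record rfunctional (T : MP -> M) : Prop := RFun {
  rfunD : forall F G, T (F + G) = T F + T G;
  rfunZ : forall m F, T (cst m *m F) = T F *m m^T }.

Lemma rfun_sum T n (F : nat -> MP) : rfunctional T ->
  T (\sum_(i < n) F i) = \sum_(i < n) T (F i).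
Proof.
move=> fT; elim: n => [|n IH]; last by rewrite !big_ord_recr /= rfunD// IH.
rewrite !big_ord0; have := rfunD fT 0 0; rewrite addr0.
by move/(congr1 (fun X => X - T 0)); rewrite addrK subrr.
Qed.

Lemma rfun_lsum T n c (F : nat -> MP) : rfunctional T ->
  T (lsum n c F) = \sum_(i < n) T (F i) *m (c i)^T.
Proof.
move=> fT; rewrite (rfun_sum n (fun i => cst (c i) *m F i))//.
by apply: eq_bigr => i _; rewrite rfunZ.
Qed.

(** Substituting one family into combinations of another multiplies the
    coefficient matrices. *)
Lemma lsum_lsum n (c : nat -> M) A (F G : nat -> MP) : lower A ->
  (forall k, F k = lsum k.+1 (A k) G) ->
  lsum n c F = lsum n (fun i => \sum_(k < n) c k *m A k i) G.
Proof.
move=> lA FE; rewrite /lsum.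
transitivity (\sum_(k < n) \sum_(i < n) cst (c k *m A k i) *m G i).
  apply: eq_bigr => k _; rewrite FE /lsum mulmx_sumr.
  rewrite [RHS](@sum_ltn_widen _ k.+1 n (fun i => cst (c k *m A k i) *m G i))//.
    by apply: eq_bigr => i _; rewrite mulmxA map_mxM.
  by move=> i /andP[ki _]; rewrite lA// mulmx0 map_mx0 mul0mx.
rewrite exchange_big; apply: eq_bigr => i _.
by rewrite raddf_sum mulmx_suml.
Qed.

Lemma bpolyE S n : bpoly S n = lsum n.+1 (S n) Xpow.
Proof. exact: matpolyE. Qed.

Lemma lsum_idb n (G : nat -> MP) : lsum n.+1 (@idb R p n) G = G n.
Proof.
rewrite /lsum big_ord_recr /= big1 ?add0r => [|i _]; last first.
  by rewrite /idb gtn_eqF ?ltn_ord// map_mx0 mul0mx.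
by rewrite /idb eqxx map_mx1 mul1mx.
Qed.

Lemma Xpow_bpoly S L n : lower_unitriangular S -> ltinverse S L ->
  Xpow n = lsum n.+1 (L n) (bpoly S).
Proof.
move=> [_ lS] [_ _ LS]; rewrite (lsum_lsum _ _ lS (bpolyE S)).
rewrite -[LHS](lsum_idb n) -LS; apply: eq_bigr => i _; congr (cst _ *m _).
Qed.

Lemma bpoly_connection S L S' n : lower_unitriangular S -> ltinverse S L ->
  bpoly S' n = lsum n.+1 (ltmul S' L n) (bpoly S).
Proof.
move=> hS iS; have [[_ lL] _ _] := iS.
by rewrite bpolyE (lsum_lsum _ _ lL (fun k => Xpow_bpoly k hS iS)).
Qed.

Record sesquilinear (B : MP -> MP -> M) : Prop := Sesq {
  sesqD : forall F F' G, B (F + F') G = B F G + B F' G;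
  sesqZ : forall m F G, B (cst m *m F) G = m *m B F G;
  sesqr : forall F, rfunctional (B F) }.

Lemma sesq_lsum B n c (F : nat -> MP) G : sesquilinear B ->
  B (lsum n c F) G = \sum_(i < n) c i *m B (F i) G.
Proof.
move=> sB; rewrite /lsum; elim: n => [|n IH].
  rewrite !big_ord0; have := sesqD sB 0 0 G; rewrite addr0.
  by move/(congr1 (fun X => X - B 0 G)); rewrite addrK subrr.
by rewrite !big_ord_recr /= sesqD// IH sesqZ.
Qed.

Definition bgram (B : MP -> MP -> M) : bmx R p := fun k l => B (Xpow k) (Xpow l).

Section Biorthogonality.
Variables (B : MP -> MP -> M) (S1 S2 L1 L2 : bmx R p) (H : nat -> M).
Hypothesis sB : sesquilinear B.
Hypotheses (hS1 : lower_unitriangular S1) (hS2 : lower_unitriangular S2).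
Hypotheses (iS1 : ltinverse S1 L1) (iS2 : ltinverse S2 L2).
Hypothesis hG : bgram B = ltmul L1 (ltmul (diagb H) (trb L2)).

(** [S1 G = H L2^T], read blockwise. *)
Lemma bpoly_Xpow n l : B (bpoly S1 n) (Xpow l) = H n *m (L2 l n)^T.
Proof.
have [[_ lL1] SL _] := iS1.
rewrite bpolyE sesq_lsum// -[LHS]/(ltmul S1 (bgram B) n l) hG.
by rewrite ltmulA// SL ltmul1 ltmul_diagb.
Qed.

Lemma bpoly_Xpow_lt n l : (l < n)%N -> B (bpoly S1 n) (Xpow l) = 0.
Proof.
by move=> ln; rewrite bpoly_Xpow; have [[_ ->]] := iS2; rewrite ?trmx0 ?mulmx0.
Qed.

Lemma bpoly_Xpow_diag n : B (bpoly S1 n) (Xpow n) = H n.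
Proof. by rewrite bpoly_Xpow; have [[-> _] _ _] := iS2; rewrite trmx1 mulmx1. Qed.

(** [S1 G S2^T = H]: biorthogonality. *)
Lemma bpoly_bpoly n m : B (bpoly S1 n) (bpoly S2 m) = diagb H n m.
Proof.
have [_ SL _] := iS2.
rewrite [bpoly S2 m]bpolyE (rfun_lsum _ _ _ (sesqr sB _)).
transitivity (H n *m (ltmul S2 L2 m n)^T).
  rewrite /ltmul raddf_sum mulmx_sumr; apply: eq_bigr => l _.
  by rewrite bpoly_Xpow /= trmx_mul mulmxA.
rewrite SL /idb /diagb eq_sym.
by case: eqP => _; rewrite ?trmx1 ?mulmx1// trmx0 mulmx0.
Qed.

Lemma Xpow_bpoly_lt k n : (k < n)%N -> B (Xpow k) (bpoly S2 n) = 0.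
Proof.
move=> kn; rewrite (Xpow_bpoly k hS1 iS1) sesq_lsum// big1// => i _.
rewrite bpoly_bpoly /diagb ltn_eqF ?mulmx0//.
by rewrite (leq_trans (ltn_ord i)).
Qed.

(** If [K H_k = 0] then [K] times row [k] of [S1] annihilates the truncated Gram
    matrix, by [bpoly_Xpow]; its last block is [K], as [S1] is unitriangular. *)
Lemma pivot_unit : (forall k, (0 < k)%N -> \det (trunc (bgram B) k) != 0) ->
  forall k, H k \in unitmx.
Proof.
move=> qd k; rewrite -row_free_unit -kermx_eq0; set K := kermx (H k).
have KH : K *m H k = 0 by exact: mulmx_ker.
have Gu : trunc (bgram B) k.+1 \in unitmx by rewrite unitmxE unitfE qd.
have E : (\mxrow_(i < k.+1) (K *m S1 k i)) *m trunc (bgram B) k.+1 = 0.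
  rewrite (mul_mxrow_trunc _ (fun i => K *m S1 k i)).
  rewrite -[RHS](mxrow0 (q_ := fun=> p)); apply: eq_mxrow => j.
  under eq_bigr do rewrite -mulmxA.
  rewrite -mulmx_sumr -(sesq_lsum _ _ _ _ sB) -bpolyE bpoly_Xpow.
  by rewrite mulmxA KH mul0mx.
have {}E : \mxrow_(i < k.+1) (K *m S1 k i) = 0.
  by rewrite -[LHS](mulmxK Gu) E mul0mx.
have [S1k _] := hS1.
have := congr1 (fun X => submxrow X ord_max) E.
by rewrite submxrow0 mxrowK /= S1k mulmx1 => ->.
Qed.

End Biorthogonality.

End Algebra.

(** * Sesquilinearity of the form *)

Section FormSesq.
Variables (R : realType) (p : nat).
Local Notation C := R[i].
Implicit Types F G : 'M[{poly C}]_p.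
Variables (u : 'M[functional R]_p) (M : R).
Hypothesis tu : tame u M.

Definition poly_form F G := Defs.form u (rmeval F) (rmeval G).

Lemma tame_pairingD k l (f g : R * R -> C) : smooth f -> smooth g ->
  pairing (u k l) (fun z => f z + g z) = pairing (u k l) f + pairing (u k l) g.
Proof.
move=> sf sg; have [chi [tchi chiE]] := tame_pairing p M.
rewrite !(chiE u)//; last exact: smoothD.
rewrite -functionalD; try exact: test_mul; last exact: (tame_linear tu k l).
by congr (u k l); apply/funext => z; rewrite mulrDr.
Qed.

Lemma smooth_entries F G i j k l :
  smooth (fun z : R * R => rmeval F z.1 i k * rmeval G z.2 j l).
Proof. by apply: smoothM; [exact: smooth_entry1|exact: smooth_entry2]. Qed.

Lemma rmevalD F G x i k :
  rmeval (F + G) x i k = rmeval F x i k + rmeval G x i k.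
Proof. by rewrite !mxE hornerD. Qed.

Lemma rmevalZ (m : 'M[C]_p) F x i k :
  rmeval (map_mx polyC m *m F) x i k = \sum_n m i n * rmeval F x n k.
Proof.
rewrite !mxE horner_sum; apply: eq_bigr => n _.
by rewrite hornerM !mxE hornerC.
Qed.

Lemma poly_form_sesquilinear : sesquilinear poly_form.
Proof.
split=> [F F' G|m F G|F].
- apply/matrixP => i j; rewrite !mxE -big_split /=; apply: eq_bigr => k _.
  rewrite -big_split /=; apply: eq_bigr => l _.
  rewrite -tame_pairingD; try exact: smooth_entries.
  by congr pairing; apply/funext => z; rewrite rmevalD mulrDl.
- apply/matrixP => i j; rewrite !mxE.
  under [RHS]eq_bigr => n _ do rewrite mxE mulr_sumr.
  rewrite [RHS]exchange_big /=; apply: eq_bigr => k _.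
  under [RHS]eq_bigr => n _ do rewrite mulr_sumr.
  rewrite [RHS]exchange_big /=; apply: eq_bigr => l _.
  rewrite -(@tame_pairing_sum _ _ _ _ tu _ _ k l (m i)
    (fun n z => rmeval F z.1 n k * rmeval G z.2 j l)) => [|n];
    last exact: smooth_entries.
  congr pairing; apply/funext => z; rewrite rmevalZ mulr_suml.
  by apply: eq_bigr => n _; rewrite mulrA.
- split=> [G G'|m G].
    apply/matrixP => i j; rewrite !mxE -big_split /=; apply: eq_bigr => k _.
    rewrite -big_split /=; apply: eq_bigr => l _.
    rewrite -tame_pairingD; try exact: smooth_entries.
    by congr pairing; apply/funext => z; rewrite rmevalD mulrDr.
  apply/matrixP => i j; rewrite !mxE.
  under [RHS]eq_bigr => n _ do rewrite !mxE mulr_suml.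
  rewrite [RHS]exchange_big /=; apply: eq_bigr => k _.
  under [RHS]eq_bigr => n _ do rewrite mulr_suml.
  rewrite [RHS]exchange_big /=; apply: eq_bigr => l _.
  under [RHS]eq_bigr => n _ do rewrite mulrC.
  rewrite -(@tame_pairing_sum _ _ _ _ tu _ _ k l (m j)
    (fun n z => rmeval F z.1 i k * rmeval G z.2 n l)) => [|n];
    last exact: smooth_entries.
  congr pairing; apply/funext => z; rewrite rmevalZ mulr_sumr.
  by apply: eq_bigr => n _; rewrite mulrCA.
Qed.

End FormSesq.

(** * Quasideterminants and the connection matrix *)

Section Quasidet.
Variables (R : realType) (p : nat).
Local Notation C := R[i].
Local Notation M := 'M[C]_p.

(** A quasideterminant evaluates [E - c B] at the solution [c] of [c A = D]. *)
Lemma quasidet_row m (A : 'M[C]_m) B (c D : 'M[C]_(p, m)) (E : M) :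
  A \in unitmx -> c *m A = D -> last_quasidet A B D E = E - c *m B.
Proof. by move=> uA <-; rewrite /last_quasidet mulmxK. Qed.

Lemma quasidet_col m (A : 'M[C]_m) (c B : 'M[C]_(m, p)) (D : 'M[C]_(p, m))
    (E : M) :
  A \in unitmx -> A *m c = B -> last_quasidet A B D E = E - D *m c.
Proof. by move=> uA <-; rewrite /last_quasidet -mulmxA mulKmx. Qed.

Section Select.
Variables (N n : nat) (I : 'I_(\sum_(k < N) p) -> 'I_n * 'I_p).

Lemma eq_sel (f g : nat -> M) : (forall l, (l < n)%N -> f l = g l) ->
  sel I f = sel I g.
Proof. by move=> fg; apply/matrixP => a b; rewrite !mxE fg. Qed.

Lemma selN (f : nat -> M) : sel I (fun l => - f l) = - sel I f.
Proof. by apply/matrixP => a b; rewrite !mxE. Qed.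

Lemma mul_mxrow_Rsq (c : nat -> M) (A : bmx R p) :
  (\mxrow_(j < N) c j) *m Rsq I A =
  sel I (fun l => \sum_(j < N) c j *m A (n - N + j)%N l).
Proof.
rewrite /Rsq mul_mxrow_mxcol; apply/matrixP => a b.
rewrite summxE !mxE summxE; apply: eq_bigr => j _.
by rewrite !mxE; apply: eq_bigr => k _; rewrite mxE.
Qed.

End Select.

Lemma mul_mxrow_first N (c : nat -> M) (X : M) : (0 < N)%N ->
  (\mxrow_(j < N) c j) *m first_block N X = c 0 *m X.
Proof.
case: N => // N _; rewrite /first_block mul_mxrow_mxcol.
rewrite big_ord_recl /= big1 ?addr0// => j _.
by rewrite mulmx0.
Qed.

Lemma sum_band (V : nmodType) N n (x : nat -> V) : (N <= n)%N ->
  (forall k, (k + N < n)%N -> x k = 0) ->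
  \sum_(k < n) x k = \sum_(j < N) x (n - N + j)%N.
Proof.
move=> Nn x0; rewrite -[in LHS](subnK Nn) big_split_ord /= big1 ?add0r// => i _.
by apply: x0; have := ltn_ord i; lia.
Qed.

End Quasidet.

Section Connection.
Variables (R : realType) (p : nat).
Local Notation C := R[i].
Local Notation M := 'M[C]_p.
Local Notation MP := 'M[{poly C}]_p.
Local Notation cst := (map_mx polyC).
Local Notation Xpow := (@Xpow R p).

Variables (B Bc : MP -> MP -> M) (N : nat) (A : nat -> M).
Variables (S1 S2 L1 L2 Sc1 Sc2 Lc1 Lc2 : bmx R p) (H Hc : nat -> M).
Hypotheses (sB : sesquilinear B) (sBc : sesquilinear Bc).
Hypotheses (hS1 : lower_unitriangular S1) (hS2 : lower_unitriangular S2).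
Hypotheses (iS1 : ltinverse S1 L1) (iS2 : ltinverse S2 L2).
Hypothesis hG : bgram B = ltmul L1 (ltmul (diagb H) (trb L2)).
Hypotheses (hSc1 : lower_unitriangular Sc1) (hSc2 : lower_unitriangular Sc2).
Hypotheses (iSc1 : ltinverse Sc1 Lc1) (iSc2 : ltinverse Sc2 Lc2).
Hypothesis hGc : bgram Bc = ltmul Lc1 (ltmul (diagb Hc) (trb Lc2)).
Let W := matpoly N A.
Hypothesis BW : forall F G, Bc F (G *m W^T) = B F G.
Hypotheses (Hu : forall k, H k \in unitmx) (Hcu : forall k, Hc k \in unitmx).

Let Rm : bmx R p := fun k l => Bc (bpoly S1 k) (Xpow l).
Let w := ltmul Sc1 L1.

Lemma connection n : bpoly Sc1 n = lsum n.+1 (w n) (bpoly S1).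
Proof. exact: bpoly_connection. Qed.

Lemma connection_diag n : w n n = 1%:M.
Proof.
have [[L11 L10] _ _] := iS1; have [S11 _] := hSc1.
rewrite /w /ltmul big_ord_recr /= big1 ?add0r ?S11 ?L11 ?mulmx1// => j _.
by rewrite L10 ?mulmx0.
Qed.

(** The degree count behind all the formulas: [P2_k W^T] has degree [k + N] and
    coefficient [A_N^T] there, as [P2_k] is monic, so a functional that kills
    the degrees below [n] sees at most that coefficient. *)
Lemma rfun_mulWT (T : MP -> M) n k : rfunctional T ->
  (forall j, (j < n)%N -> T (Xpow j) = 0) -> (k + N <= n)%N ->
  T (bpoly S2 k *m W^T) = if (k + N == n)%N then T (Xpow n) *m A N else 0.
Proof.
move=> fT T0 kn.
have -> : bpoly S2 k *m W^T = \sum_(a < k.+1) \sum_(m < N.+1)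
    cst (S2 k a *m (A m)^T) *m Xpow (a + m)%N.
  rewrite bpolyE /lsum mulmx_suml; apply: eq_bigr => a _.
  rewrite /W matpolyE /lsum raddf_sum mulmx_sumr; apply: eq_bigr => m _ /=.
  rewrite trmx_mul /Xpow tr_scalar_mx -!mulmxA map_mxM -mulmxA map_trmx.
  congr (_ *m _); rewrite mulmxA -scalar_mxM -exprD.
  by rewrite mul_mx_scalar mul_scalar_mx.
rewrite (rfun_sum _ (fun a => \sum_(m < N.+1)
    cst (S2 k a *m (A m)^T) *m Xpow (a + m)%N))//.
have inner a : T (\sum_(m < N.+1) cst (S2 k a *m (A m)^T) *m Xpow (a + m)%N) =
    \sum_(m < N.+1) T (Xpow (a + m)%N) *m (S2 k a *m (A m)^T)^T.
  rewrite (rfun_sum _ (fun m => cst (S2 k a *m (A m)^T) *m Xpow (a + m)%N))//.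
  by apply: eq_bigr => m _; rewrite rfunZ.
under eq_bigr do rewrite inner.
rewrite big_ord_recr /= big1 ?add0r; last first.
  move=> a _; rewrite big1// => m _; rewrite T0 ?mul0mx//.
  by have := ltn_ord a; have := ltn_ord m; lia.
rewrite big_ord_recr /= big1 ?add0r; last first.
  move=> m _; rewrite T0 ?mul0mx//.
  by have := ltn_ord m; lia.
have [-> _] := hS2; rewrite mul1mx trmxK.
by case: eqP => [->//|/eqP nn]; rewrite T0 ?mul0mx// ltn_neqAle nn.
Qed.

(** Both sides are [<Pc1_n, P2_i>_u]: expand [Pc1_n] in the [P1_k] on the left,
    move [W] across on the right. *)
Lemma connection_pivot n i : (i <= n)%N ->
  w n i *m H i = Bc (bpoly Sc1 n) (bpoly S2 i *m W^T).
Proof.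
move=> ni; rewrite BW connection sesq_lsum//.
rewrite (bigD1 (Ordinal (ni : (i < n.+1)%N)))//= big1 ?addr0 => [|j ji].
  by rewrite (bpoly_bpoly sB iS1 iS2 hG) /diagb eqxx.
rewrite (bpoly_bpoly sB iS1 iS2 hG) /diagb ifN ?mulmx0//.
Qed.

Lemma connection_band n i : (i + N < n)%N -> w n i = 0.
Proof.
move=> iNn; rewrite -[LHS](mulmxK (Hu i)) connection_pivot; last by lia.
rewrite (rfun_mulWT (sesqr sBc _) (n := n)) ?ltn_eqF ?mul0mx//; last exact: ltnW.
by move=> j jn; exact: (bpoly_Xpow_lt sBc iSc1 iSc2 hGc).
Qed.

Lemma connection_lead n i : (i + N = n)%N -> w n i *m H i = Hc n *m A N.
Proof.
move=> iNn; rewrite connection_pivot; last by lia.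
rewrite (rfun_mulWT (sesqr sBc _) (n := n)) ?iNn ?eqxx//.
  by rewrite (bpoly_Xpow_diag sBc iSc1 iSc2 hGc).
by move=> j jn; exact: (bpoly_Xpow_lt sBc iSc1 iSc2 hGc).
Qed.

Lemma connection_row n l :
  Bc (bpoly Sc1 n) (Xpow l) = Rm n l + \sum_(k < n) w n k *m Rm k l.
Proof.
rewrite connection sesq_lsum// big_ord_recr /= connection_diag mul1mx.
by rewrite addrC.
Qed.

Lemma connection_meval n x : meval (bpoly Sc1 n) x =
  meval (bpoly S1 n) x + \sum_(k < n) w n k *m meval (bpoly S1 k) x.
Proof.
rewrite connection meval_lsum big_ord_recr /= connection_diag mul1mx.
by rewrite addrC.
Qed.

Section Poised.
Variables (n : nat) (Nn : (N <= n)%N).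
Variable I : 'I_(\sum_(k < N) p) -> 'I_n * 'I_p.
Hypothesis uR : Rsq I Rm \in unitmx.

Let row_w : 'M[C]_(p, \sum_(k < N) p) := \mxrow_(j < N) w n (n - N + j)%N.

(** The orthogonality of [Pc1_n] to [y^l], for [l < n], is this system: the
    connection coefficients below the band vanish, and that of [P1_n] is 1. *)
Lemma row_wE : - row_w *m Rsq I Rm = sel I (Rm n).
Proof.
rewrite mulNmx (mul_mxrow_Rsq I (fun j => w n (n - N + j)%N)) -selN.
apply: eq_sel => l ln.
rewrite -(sum_band (N := N) (x := fun k => w n k *m Rm k l))//; last first.
  by move=> k kn; rewrite connection_band// mul0mx.
apply/eqP; rewrite eq_sym -subr_eq0 opprK -connection_row.
by rewrite (bpoly_Xpow_lt sBc iSc1 iSc2 hGc).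
Qed.

Lemma row_w_mul (X : nat -> M) :
  row_w *m (\mxcol_(k < N) X (n - N + k)%N) = \sum_(k < n) w n k *m X k.
Proof.
rewrite mul_mxrow_mxcol (sum_band (N := N) (x := fun k => w n k *m X k))//.
by move=> k kn; rewrite connection_band// mul0mx.
Qed.

Lemma poised_first_family x : meval (bpoly Sc1 n) x =
  last_quasidet (Rsq I Rm) (\mxcol_(k < N) meval (bpoly S1 (n - N + k)%N) x)
    (sel I (Rm n)) (meval (bpoly S1 n) x).
Proof.
rewrite (quasidet_row _ _ uR row_wE) mulNmx opprK.
by rewrite (row_w_mul (fun k => meval (bpoly S1 k) x)) connection_meval.
Qed.

Lemma poised_pivot : Hc n =
  last_quasidet (Rsq I Rm) (\mxcol_(k < N) Rm (n - N + k)%N n)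
    (sel I (Rm n)) (Rm n n).
Proof.
rewrite (quasidet_row _ _ uR row_wE) mulNmx opprK (row_w_mul (fun k => Rm k n)).
by rewrite -connection_row (bpoly_Xpow_diag sBc iSc1 iSc2 hGc).
Qed.

Lemma poised_pivot_lead : (0 < N)%N -> Hc n *m A N =
  last_quasidet (Rsq I Rm) (first_block N (H (n - N)%N)) (sel I (Rm n)) 0.
Proof.
move=> N0; rewrite (quasidet_row _ _ uR row_wE) mulNmx opprK add0r.
rewrite (mul_mxrow_first (fun j => w n (n - N + j)%N))// addn0.
by rewrite connection_lead// subnK.
Qed.

Section Kernel.
Variable z : C.
Hypothesis N0 : (0 < N)%N.

Let P2 k := meval (bpoly S2 k) z.
Let Pc2 k := meval (bpoly Sc2 k) z.
Let Kc := lsum n (fun k => (Pc2 k)^T *m invmx (Hc k)) (bpoly Sc1).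
(* How far the perturbed Christoffel-Darboux kernel is from reproducing F(z). *)
Let defect (F : MP) : M := (meval F z)^T - Bc Kc F.

Lemma defect_rfun : rfunctional defect.
Proof.
split=> [F G|m F].
  rewrite /defect (rfunD (sesqr sBc _)).
  have -> : meval (F + G) z = meval F z + meval G z.
    exact: (map_mxD (horner_eval z)).
  by rewrite raddfD opprD addrACA.
rewrite /defect (rfunZ (sesqr sBc _)) mevalM mulmxBl.
rewrite trmx_mul; congr (_ *m _^T - _).
by apply/matrixP => i j; rewrite !mxE hornerC.
Qed.

Lemma defect_bpoly k :
  defect (bpoly Sc2 k) = if (k < n)%N then 0 else (Pc2 k)^T.
Proof.
rewrite /defect sesq_lsum// -/(Pc2 k).
have E i : (Pc2 i)^T *m invmx (Hc i) *m Bc (bpoly Sc1 i) (bpoly Sc2 k) =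
    if i == k then (Pc2 k)^T else 0.
  rewrite (bpoly_bpoly sBc iSc1 iSc2 hGc) /diagb.
  by case: eqP => [->|_]; rewrite ?mulmxKV// mulmx0.
under eq_bigr do rewrite E.
case: ifP => kn.
  by rewrite -big_mkcond (big_pred1 (Ordinal kn)) ?subrr.
rewrite big1 ?subr0// => i _; rewrite ifN//.
by apply: contraFneq kn => <-; exact: ltn_ord.
Qed.

Lemma defect_Xpow_lt j : (j < n)%N -> defect (Xpow j) = 0.
Proof.
move=> jn; rewrite (Xpow_bpoly j hSc2 iSc2) (rfun_lsum _ _ _ defect_rfun).
rewrite big1// => i _; rewrite defect_bpoly.
by rewrite (leq_trans (ltn_ord i))// mul0mx.
Qed.

Lemma defect_Xpow : defect (Xpow n) = (Pc2 n)^T.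
Proof.
have := defect_bpoly n; rewrite ltnn => <-.
rewrite bpolyE (rfun_lsum _ _ _ defect_rfun) big_ord_recr /= big1 ?add0r.
  by have [-> _] := hSc2; rewrite trmx1 mulmx1.
by move=> i _; rewrite defect_Xpow_lt ?mul0mx.
Qed.

Let K := cst (meval W z) *m CDkernel S1 S2 H n.-1 z.
Let kap k := meval W z *m (P2 k)^T *m invmx (H k).
Let gam i := \sum_(k < n) (Pc2 k)^T *m invmx (Hc k) *m w k i.

Lemma n_gt0 : n.-1.+1 = n. Proof. by rewrite prednK// (leq_trans N0). Qed.

Lemma KE : K = lsum n kap (bpoly S1).
Proof.
rewrite /K /CDkernel n_gt0 mulmx_sumr; apply: eq_bigr => k _.
by rewrite mulmxA -map_mxM mulmxA.
Qed.

Lemma KcE : Kc = lsum n gam (bpoly S1).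
Proof.
have [[_ lL] _ _] := iS1.
rewrite /Kc (lsum_lsum n _ (A := w) _ connection)//.
exact: ltmul_lower.
Qed.

(** [kap k - gam k] is the coefficient on [P1_k] of [W(z) K_{n-1} - Kc_{n-1}];
    pairing with [P2_k] for [u] isolates it, and moving [W] across turns the
    second kernel's share into a pairing for [uc]. *)
Lemma coef_defect k : (k < n)%N ->
  (kap k - gam k) *m H k = defect (bpoly S2 k *m W^T).
Proof.
move=> kn; rewrite /defect BW KcE sesq_lsum// mulmxBl mulmxKV//; congr (_ - _).
  by rewrite mevalM trmx_mul; congr (_ *m _); apply/matrixP => i j; rewrite !mxE.
rewrite (bigD1 (Ordinal kn))//= big1 ?addr0 => [|j jk].
  by rewrite (bpoly_bpoly sB iS1 iS2 hG) /diagb eqxx.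
by rewrite (bpoly_bpoly sB iS1 iS2 hG) /diagb ifN ?mulmx0.
Qed.

Lemma coef_band k : (k + N < n)%N -> kap k - gam k = 0.
Proof.
move=> kn; rewrite -[LHS](mulmxK (Hu k)) coef_defect; last by lia.
rewrite (rfun_mulWT defect_rfun (n := n)) ?ltn_eqF ?mul0mx//; last exact: ltnW.
exact: defect_Xpow_lt.
Qed.

Lemma coef_lead :
  (kap (n - N)%N - gam (n - N)%N) *m H (n - N)%N = (Pc2 n)^T *m A N.
Proof.
rewrite coef_defect; last by lia.
rewrite (rfun_mulWT defect_rfun (n := n)) ?subnK ?eqxx ?defect_Xpow//.
exact: defect_Xpow_lt.
Qed.

(** For [l < n] the perturbed kernel reproduces [z^l], so that [r^K_{n,l}(z)] is
    the moment of the difference of the two kernels. *)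
Lemma kernel_row l : (l < n)%N ->
  Bc K (Xpow l) - (z ^+ l)%:M =
  \sum_(j < N) (kap (n - N + j)%N - gam (n - N + j)%N) *m Rm (n - N + j)%N l.
Proof.
move=> ln; rewrite -(sum_band (N := N) (x := fun k => (kap k - gam k) *m Rm k l))//.
  have := defect_Xpow_lt ln; rewrite /defect meval_Xpow tr_scalar_mx.
  move/eqP; rewrite subr_eq0 => /eqP ->.
  rewrite KE KcE !sesq_lsum// -sumrB; apply: eq_bigr => k _.
  by rewrite mulmxBl.
by move=> k kn; rewrite coef_band// mul0mx.
Qed.

Lemma poised_second_family : (Pc2 n)^T *m A N =
  - last_quasidet (Rsq I Rm) (first_block N (H (n - N)%N))
      (sel I (fun l => Bc K (Xpow l) - (z ^+ l)%:M)) 0.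
Proof.
pose c j := kap (n - N + j)%N - gam (n - N + j)%N.
rewrite (@quasidet_row _ _ _ _ _ (\mxrow_(j < N) c j))//.
  by rewrite sub0r opprK mul_mxrow_first// /c addn0 coef_lead.
rewrite mul_mxrow_Rsq; apply: eq_sel => l ln.
by rewrite kernel_row.
Qed.

End Kernel.
End Poised.

Section Low.
Variable n : nat.
Hypothesis uG : trunc (bgram Bc) n \in unitmx.

Lemma moment_ltmul : Rm = ltmul S1 (bgram Bc).
Proof.
apply/funext => k; apply/funext => l.
by rewrite /Rm bpolyE sesq_lsum.
Qed.

(** [R = S1 Gc], and truncation is multiplicative on a lower triangular left
    factor. *)
Lemma trunc_moment_unit : trunc Rm n \in unitmx.
Proof.
have [[_ lL] _ LS] := iS1; have [_ lS] := hS1.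
rewrite moment_ltmul -trunc_ltmul// unitmx_mul uG andbT.
have := @trunc_ltmul _ _ n _ S1 lL; rewrite LS trunc_idb.
by move=> /mulmx1_unit[].
Qed.

Let row_w : 'M[C]_(p, \sum_(k < n) p) := \mxrow_(k < n) w n k.

Lemma trunc_row : - row_w *m trunc Rm n = \mxrow_(j < n) Rm n j.
Proof.
rewrite mulNmx (mul_mxrow_trunc _ (w n)) -mxrowN; apply: eq_mxrow => j.
apply/eqP; rewrite eq_sym -subr_eq0 opprK -connection_row.
by rewrite (bpoly_Xpow_lt sBc iSc1 iSc2 hGc).
Qed.

Lemma trunc_first_family x : meval (bpoly Sc1 n) x =
  last_quasidet (trunc Rm n) (\mxcol_(i < n) meval (bpoly S1 i) x)
    (\mxrow_(j < n) Rm n j) (meval (bpoly S1 n) x).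
Proof.
rewrite (quasidet_row _ _ trunc_moment_unit trunc_row) mulNmx opprK.
by rewrite mul_mxrow_mxcol connection_meval.
Qed.

Lemma trunc_pivot : Hc n =
  last_quasidet (trunc Rm n) (\mxcol_(i < n) Rm i n)
    (\mxrow_(j < n) Rm n j) (Rm n n).
Proof.
rewrite (quasidet_row _ _ trunc_moment_unit trunc_row) mulNmx opprK.
rewrite mul_mxrow_mxcol.
by rewrite -connection_row (bpoly_Xpow_diag sBc iSc1 iSc2 hGc).
Qed.

(** [Pc2_n] is orthogonal to [P1_i] for [i < n], the latter having degree below
    [n]; its lower coefficients solve this system. *)
Lemma trunc_col :
  trunc Rm n *m - (\mxcol_(j < n) (Sc2 n j)^T) = \mxcol_(i < n) Rm i n.
Proof.
rewrite mulmxN mul_mxblock_mxrow -mxcolN; apply: eq_mxcol => i.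
apply/eqP; rewrite eq_sym -subr_eq0 opprK.
have : Bc (bpoly S1 i) (bpoly Sc2 n) = 0.
  rewrite [bpoly S1 i]bpolyE sesq_lsum// big1// => k _.
  rewrite (Xpow_bpoly_lt sBc hSc1 iSc1 iSc2 hGc) ?mulmx0//.
  by rewrite (leq_ltn_trans _ (ltn_ord i)) -1?ltnS.
rewrite [bpoly Sc2 n]bpolyE (rfun_lsum _ _ _ (sesqr sBc _)) big_ord_recr /=.
by have [-> _] := hSc2; rewrite trmx1 mulmx1 addrC => /eqP.
Qed.

Lemma trunc_second_family y : (meval (bpoly Sc2 n) y)^T =
  last_quasidet (trunc Rm n) (\mxcol_(i < n) Rm i n)
    (\mxrow_(j < n) (y ^+ j)%:M) (y ^+ n)%:M.
Proof.
rewrite (quasidet_col _ _ trunc_moment_unit trunc_col) mulmxN opprK.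
rewrite mul_mxrow_mxcol.
rewrite bpolyE meval_lsum raddf_sum big_ord_recr /= meval_Xpow.
have [-> _] := hSc2; rewrite mul1mx tr_scalar_mx addrC; congr (_ + _).
apply: eq_bigr => j _; rewrite meval_Xpow trmx_mul tr_scalar_mx//.
Qed.

End Low.
End Connection.

(** * The perturbation formulas *)

Section Final.
Variables (R : realType) (p : nat).
Local Notation C := R[i].

Lemma mono_Xpow l : @mono R p l = rmeval (Xpow R p l).
Proof. by apply/funext => t; rewrite /rmeval meval_Xpow. Qed.

Lemma gram_poly_form (u : 'M[functional R]_p) : gram u = bgram (poly_form u).
Proof.
by apply/funext => k; apply/funext => l; rewrite /gram !mono_Xpow.
Qed.

Lemma trunc_unit (G : bmx R p) n :
  (forall k, (0 < k)%N -> \det (trunc G k) != 0) -> trunc G n \in unitmx.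
Proof.
case: n => [_|n]; last by move=> /(_ n.+1 isT); rewrite unitmxE unitfE.
rewrite (_ : trunc G 0 = 1%:M) ?unitmx1//.
by apply/matrixP => -[i i0]; exfalso; move: i0; rewrite big_ord0.
Qed.

Lemma spectrum_unit (u : 'M[functional R]_p) (W : 'M[{poly C}]_p) :
  spectrum W `&` [set t%:C | t in supp_y u] = set0 ->
  forall k l z, dsupp (u k l) z -> rmeval W z.2 \in unitmx.
Proof.
move=> sW k l [x y] uz; rewrite unitmxE unitfE.
have -> : \det (rmeval W y) = (\det W).[y%:C].
  by rewrite -[RHS]/(horner_eval _ _) -det_map_mx.
apply/negP => Wy; suff : set0 (y%:C) by [].
by rewrite -sW; split=> //; exists y => //; exists k, l, x.
Qed.

End Final.

Theorem theorem4 (R : realType) (p : nat) (u v : 'M[functional R]_p)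
  (N : nat) (A : nat -> 'M[R[i]]_p)
  (S1 S2 Sc1 Sc2 : bmx R p) (H Hc : nat -> 'M[R[i]]_p) :
  let W := matpoly N A in
  let uc := addk (divk u W) v in
  let P1 n x := meval (bpoly S1 n) x in
  let Pc1 n x := meval (bpoly Sc1 n) x in
  let Pc2 n y := meval (bpoly Sc2 n) y in
  let Rm := Rmx uc S1 in
  let rk n y l := rK uc W S1 S2 H n l y in
  (0 < p)%N ->
  generalized_kernel u ->
  generalized_kernel v ->
  A N != 0 ->
  spectrum W `&` [set t%:C | t in supp_y u] = set0 ->
  null_kernel (mulk v W) ->
  quasidefinite u ->
  quasidefinite uc ->
  gauss_borel (gram u) S1 S2 H ->
  gauss_borel (gram uc) Sc1 Sc2 Hc ->
  (forall n, (N <= n)%N ->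
   forall I : 'I_(\sum_(k < N) p) -> 'I_n * 'I_p, poised I Rm ->
     [/\ forall x : R[i],
           Pc1 n x = last_quasidet (Rsq I Rm)
                       (\mxcol_(k < N) P1 (n - N + k)%N x)
                       (sel I (Rm n)) (P1 n x),
         (0 < N)%N -> forall y : R[i],
           (Pc2 n y)^T *m A N =
             - last_quasidet (Rsq I Rm) (first_block N (H (n - N)%N))
                 (sel I (rk n y)) 0,
         Hc n = last_quasidet (Rsq I Rm)
                  (\mxcol_(k < N) Rm (n - N + k)%N n)
                  (sel I (Rm n)) (Rm n n)
       & (0 < N)%N ->
           Hc n *m A N =
             last_quasidet (Rsq I Rm) (first_block N (H (n - N)%N))
               (sel I (Rm n)) 0]) /\
  (forall n, (n < N)%N ->
     [/\ trunc Rm n \in unitmx,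
         Hc n = last_quasidet (trunc Rm n) (\mxcol_(i < n) Rm i n)
                  (\mxrow_(j < n) Rm n j) (Rm n n),
         forall x : R[i],
           Pc1 n x = last_quasidet (trunc Rm n) (\mxcol_(i < n) P1 i x)
                       (\mxrow_(j < n) Rm n j) (P1 n x)
       & forall y : R[i],
           (Pc2 n y)^T = last_quasidet (trunc Rm n) (\mxcol_(i < n) Rm i n)
                           (\mxrow_(j < n) (y ^+ j)%:M) (y ^+ n)%:M]).
Proof.
move=> W uc P1 Pc1 Pc2 Rm rk _ gu gv _ sW vW qu quc gb gbc.
have [M1 tu1] := generalized_tame gu; have [M2 tv2] := generalized_tame gv.
have tu : tame u (Num.max M1 M2) by apply: tu1; rewrite le_max lexx.
have tv : tame v (Num.max M1 M2) by apply: tv2; rewrite le_max lexx orbT.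
have Wu := spectrum_unit sW.
have tuc : tame uc (Num.max M1 M2) := tame_addk_divk tu tv Wu.
have sB := poly_form_sesquilinear tu; have sBc := poly_form_sesquilinear tuc.
have BW F G : poly_form uc F (G *m W^T) = poly_form u F G.
  exact: (form_perturbation tu tv Wu vW F G).
rewrite gram_poly_form in gb; rewrite gram_poly_form in gbc.
rewrite /quasidefinite gram_poly_form in qu.
rewrite /quasidefinite gram_poly_form in quc.
have [hS1 hS2 [L1 [L2 [iS1 iS2 hG]]]] := gb.
have [hSc1 hSc2 [Lc1 [Lc2 [iSc1 iSc2 hGc]]]] := gbc.
have Hu := pivot_unit sB hS1 iS1 hG qu.
have Hcu := pivot_unit sBc hSc1 iSc1 hGc quc.
have RmE : Rm = fun k l => poly_form uc (bpoly S1 k) (Xpow R p l).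
  by apply/funext => k; apply/funext => l; rewrite /Rm /Rmx mono_Xpow.
have rkE n y : rk n y = fun l => poly_form uc (map_mx polyC (meval W y) *m
    CDkernel S1 S2 H n.-1 y) (Xpow R p l) - (y ^+ l)%:M.
  by apply/funext => l; rewrite /rk /rK mono_Xpow.
rewrite RmE; split=> [n Nn I [_ uR]|n nN].
  split.
  - exact: (poised_first_family sB sBc hS1 hS2 iS1 iS2 hG
              hSc1 iSc1 iSc2 hGc BW Hu Nn uR).
  - move=> N0 y; rewrite rkE.
    exact: (poised_second_family sB sBc hS1 hS2 iS1 iS2 hG
              hSc2 iSc1 iSc2 hGc BW Hu Hcu Nn uR).
  - exact: (poised_pivot sB sBc hS1 hS2 iS1 iS2 hG
              hSc1 iSc1 iSc2 hGc BW Hu Nn uR).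
  - exact: (poised_pivot_lead sB sBc hS1 hS2 iS1 iS2 hG
              hSc1 iSc1 iSc2 hGc BW Hu Nn uR).
have uG := trunc_unit n quc.
split.
- exact: (trunc_moment_unit sBc hS1 iS1 uG).
- exact: (trunc_pivot sBc hS1 iS1 hSc1 iSc1 iSc2 hGc uG).
- move=> x; exact: (trunc_first_family sBc hS1 iS1 hSc1 iSc1 iSc2 hGc uG).
- move=> y; exact: (trunc_second_family sBc hS1 iS1 hSc1 hSc2 iSc1 iSc2 hGc uG).
Qed.
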